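(* Let $U$ (with $\tau$-operator $\mathcal{T}$) be a folded representation over $k$ of a root datum $\Phi\hookrightarrow\Lambda^\vee$ with simple roots $\Delta$, preserving $\Theta\subset\Delta$. Let $\theta\in U$ be a dominant vector with respect to $\Delta$ whose stabilizer in $W$ is $W_\Theta$, and $\mu=\pi_*(\theta)$. Then the ring homomorphism $\iota^*\colon\mathcal{Z}(\mathcal{G})\to\mathcal{Z}(\mathcal{G}_\tau)$, $(z_x)_{x\in W\theta}\mapsto(\pi_*(z_{\iota(y)}))_{y\in W_\tau\mu}$, induces a map of the reduced structure algebras $\hat\iota^*\colon\widehat{\mathcal{Z}}(\mathcal{G})\to\widehat{\mathcal{Z}}(\mathcal{G}_\tau)$.
   Context: **Quadratic algebra.** $k$ is a subring of $\mathbb{R}$; $p(x)=x^2-c_1x+c_2$ is a polynomial over $k$ with $c_2$ and $D=c_1^2-4c_2$ invertible in $k$; $l=k[x]/(p(x))$; $\tau$ is the class of $x$ and $\sigma=c_1-\tau$, so $\tau+\sigma=c_1$, $\tau\sigma=c_2$. Write $(y,y')=y+\tau y'\in l$ for $y,y'\in k$. Two cases are considered: the split case, where $p(x)=x^2-1$, $2$ is invertible in $k$ and $l\cong k\times k$; and the non-split case, where $l\not\cong k\times k$ and $l$ is a subring of $\mathbb{R}$. **Weil restriction.** $\mathcal{U}=l^n$; $U$ is $\mathcal{U}$ viewed as a free $k$-module of rank $2n$ (coordinates $(y_i,y_i')_{i}$); for $u\in U$, $u_l$ is $u$ viewed in $\mathcal{U}$. $\mathcal{T}\colon U\to U$ is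 multiplication by $\tau$, $(\mathcal{T}u)_l=\tau u_l$. $B_\tau(u,\hat u)=pr_\tau(u_l\cdot\hat u_l)$, where $\cdot$ is the standard $l$-bilinear dot product on $\mathcal{U}$ and $pr_\tau(y+\tau y')=y$. $U_l=U\otimes_kl$, $\mathcal{T}_l$ and $B_\tau$ are extended $l$-linearly; $U_\tau$ is the $\tau$-eigenspace of $\mathcal{T}_l$ and $\pi_\tau\colon U\to U_\tau$, $\pi_\tau(u)=\frac{1}{\tau-\sigma}(\mathcal{T}u-\sigma u)$. A nonzero $u\in U$ is $\tau$-rational if $u_l\cdot u_l\in k$. **Root datum and folded representation.** A root datum is an embedding $\Phi\hookrightarrow\Lambda^\vee$, $\alpha\mapsto\alpha^\vee$, of a non-empty finite subset $\Phi$ of a free finitely generated abelian group $\Lambda$ into $\Lambda^\vee=\mathrm{Hom}(\Lambda,\mathbb{Z})$ with $\Phi\cap2\Phi=\emptyset$, $\alpha^\vee(\alpha)=2$, $\beta-\alpha^\vee(\beta)\alpha\in\Phi$ and $\beta^\vee-\beta^\vee(\alpha)\alpha^\vee\in\Phi^\vee$ for all $\alpha,\beta\in\Phi$ ($\Phi^\vee$ is the image of $\Phi$). $\Lambda_r$ is the subgroup generated by $\Phi$ (root lattice), $\Delta$ is a fixed set of simple roots, $\Phi^+$ the positive roots. $U$ is a folded representation of it if $\Phi\subset U$ (so $\Lambda_r\subset U$) and: (1) $U$ is the Weil restriction of $\mathcal{U}=l^n$ with respect to $l/k$, i.e. $U$ is the free $l$-module $\mathcal{U}=l^n$ viewed as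 a free $k$-module of rank $2n$ with coordinates $(y_i,y_i')_i$, where $l=k[x]/(p(x))$ and $x_i=y_i+\tau y_i'$ are the coordinates in $l^n$; (2) the standard dot product $B$ on $U$ in the coordinates $(y_i,y_i')$ equals $B_\tau$ (so $c_2=-1$), and $\alpha^\vee(u)=2B(\alpha,u)/B(\alpha,\alpha)$; the reflections $r_\alpha(u)=u-\alpha^\vee(u)\alpha$, $\alpha\in\Phi$, are $k$-linear automorphisms of $U$; (3) $\mathcal{T}(\Lambda_r)=\Lambda_r$; (4) $\Delta=\Delta^{\mathcal{T}}\amalg\Delta_{rat}\amalg\mathcal{T}(\Delta_{rat})$, where $\Delta^{\mathcal{T}}=\{\alpha\in\Delta:\mathcal{T}\alpha=\alpha\}$ and $\Delta_{rat}$ is a subset consisting of $\tau$-rational simple roots. In the non-split case $\tau>0$ is assumed (and then $\Delta^{\mathcal{T}}=\emptyset$). $W$ is the Weyl group generated by the $r_\alpha$, $\alpha\in\Delta$. **Convention.** In the non-split case put $U_*=U_\tau$, $\pi_*=\pi_\tau$, $l_*=l$. In the split case put $U_*=U_1=\{u\in U:\mathcal{T}u=u\}$, $\pi_*(u)=\frac12(u+\mathcal{T}u)$, $l_*=k$. **Twisted folding.** For $\alpha\in\Delta_{rat}\amalg\Delta^{\mathcal{T}}$ put $\bar\alpha=\pi_*(\alpha)$; $R_{\bar\alpha}$ is the restriction to $U_*$ of ($l_*$-linearly extended) $r_{\mathcal{T}\alpha}r_\alpha$ if $\alpha\in\Delta_{rat}$, and of $r_\alpha$ if $\alpha\in\Delta^{\mathcal{T}}$.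 $W_\tau$ is the group generated by these $R_{\bar\alpha}$; it is identified with the subgroup of $W$ generated by the corresponding $r_{\mathcal{T}\alpha}r_\alpha$ and $r_\alpha$. $\Delta_\tau=\pi_*(\Delta_{rat}\amalg\Delta^{\mathcal{T}})$, $\Phi_\tau=W_\tau(\Delta_\tau)$, $\Phi_\tau^+$ are the roots that are nonnegative combinations of $\Delta_\tau$; for $\beta=w(\bar\alpha)\in\Phi_\tau$, $R_\beta=wR_{\bar\alpha}w^{-1}$. **Parabolic data.** $(U,\mathcal{T})$ preserves $\Theta\subset\Delta$ if $\mathcal{T}(\langle\Theta\rangle_k)=\langle\Theta\rangle_k$, where $\langle\Theta\rangle_k$ is the $k$-span. $W_\Theta\subset W$ is generated by the $r_\alpha$, $\alpha\in\Theta$; $W_{\Theta_\tau}\subset W_\tau$ is generated by the $R_{\bar\alpha}$ with $\alpha\in\Theta\cap(\Delta_{rat}\amalg\Delta^{\mathcal{T}})$. A vector $\theta\in U$ is dominant if $B_\tau(\theta,\beta)\ge0$ for all $\beta\in\Delta$. The map $\iota\colon W_\tau\mu\hookrightarrow W\theta$, $w\mu\mapsto w\theta$ ($w\in W_\tau\subset W$) is a well-defined injection. **Structure algebras.** $\Lambda$ is regarded as a subgroup of $U$ containing $\Lambda_r$, stable under $\mathcal{T}$ and $W$, with $\alpha^\vee$ given by the formula $\alpha^\vee(u)=2B(\alpha,u)/B(\alpha,\alpha)$. $S=\mathrm{Sym}_k(\Lambda)$; $\Lambda_\tau$ is the $l_*$-span of $\pi_*(\Lambda)$ in $U_*$, a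 free $l_*$-module; $S_\tau=\mathrm{Sym}_{l_*}(\Lambda_\tau)$; $\pi_*$ induces a graded $k$-algebra homomorphism $\pi_*\colon S\to S_\tau$. With componentwise operations, $$\mathcal{Z}(\mathcal{G})=\Big\{(z_x)\in\bigoplus_{x\in W\theta}S : z_x-z_{r_\alpha x}\in\alpha S\ \ \forall x\in W\theta,\ \alpha\in\Phi^+\Big\},$$ $$\mathcal{Z}(\mathcal{G}_\tau)=\Big\{(b_y)\in\bigoplus_{y\in W_\tau\mu}S_\tau : b_y-b_{R_\beta y}\in\beta S_\tau\ \ \forall y\in W_\tau\mu,\ \beta\in\Phi_\tau^+\Big\}.$$ $\mathcal{I}\subset S$ and $\mathcal{I}_\tau\subset S_\tau$ are the augmentation ideals (zero constant term); $\mathcal{I}^{W_\Theta}=\mathcal{I}\cap S^{W_\Theta}$ and $\mathcal{I}_\tau^{W_{\Theta_\tau}}=\mathcal{I}_\tau\cap S_\tau^{W_{\Theta_\tau}}$. **Reduced structure algebra.** $S$ acts on $\mathcal{Z}(\mathcal{G})$ by $s\cdot(z_x)=(sz_x)$, and $S^{W_\Theta}$ acts on the right by the twisted action $(z_x)\cdot s=(z_x\,x(s))$, where $x(s):=w(s)$ for $x=w\theta$. $\widehat{\mathcal{Z}}(\mathcal{G})$ is the quotient of $\mathcal{Z}(\mathcal{G})$ by the ideal $\mathcal{I}\cdot\mathcal{Z}(\mathcal{G})+\mathcal{Z}(\mathcal{G})\cdot\mathcal{I}^{W_\Theta}$. Likewise $\widehat{\mathcal{Z}}(\mathcal{G}_\tau)$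 is the quotient of $\mathcal{Z}(\mathcal{G}_\tau)$ by $\mathcal{I}_\tau\cdot\mathcal{Z}(\mathcal{G}_\tau)+\mathcal{Z}(\mathcal{G}_\tau)\cdot\mathcal{I}_\tau^{W_{\Theta_\tau}}$. *)

(* Defs.v *)
From HB Require Import structures.
From mathcomp Require Import all_boot all_order all_algebra.
From mathcomp Require Import generic_quotient qpoly ring_quotient ring.
From mathcomp Require Import boolp classical_sets functions reals mpoly.

Set Implicit Arguments.
Unset Strict Implicit.
Unset Printing Implicit Defensive.

Import Order.TTheory GRing.Theory Num.Theory.
Local Open Scope ring_scope.

(* The [C]-linear combinations of elements of [P]: the span of [P] when [C] is
   everything, the cone of [P] when [C] is the set of nonnegative scalars. *)
Definition span_of (A : pzRingType) (V : lmodType A) (C : A -> Prop)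
    (P : V -> Prop) (v : V) : Prop :=
  exists (q : nat) (a : 'I_q -> A) (x : 'I_q -> V),
    [/\ forall i, C (a i), forall i, P (x i) & v = \sum_(i < q) a i *: x i].

(* A subgroup of the group of bijections of [X] when [G] consists of bijections. *)
Inductive generated (X : Type) (G : (X -> X) -> Prop) : (X -> X) -> Prop :=
| Gen_id : generated G id
| Gen_mul g w of G g & generated G w : generated G (g \o w)
| Gen_inv w w' of generated G w & cancel w w' & cancel w' w : generated G w'.

Definition orbit (X Y : Type) (W : (X -> X) -> Prop)
    (act : (X -> X) -> Y -> Y) (x0 : Y) : Type :=
  {y : Y | exists2 w, W w & y = act w x0}.

(* For injective [f], the preimage of a point of the image of [f]. *)
Definition preimage_pt (X : zmodType) (Y : Type) (f : X -> Y) (y : Y) : X :=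
  xget 0 [set x | f x = y]%classic.

Inductive ideal_gen (A : comPzRingType) (G : A -> Prop) : A -> Prop :=
| Ideal_0 : ideal_gen G 0
| Ideal_lin a g x of G g & ideal_gen G x : ideal_gen G (a * g + x).

Section IdealQuotient.
Variables (A : comPzRingType) (G : A -> Prop).

Lemma ideal_genD x y : ideal_gen G x -> ideal_gen G y -> ideal_gen G (x + y).
Proof.
by elim=> [|a g {}x Gg _ IH] gy; rewrite ?add0r // -addrA; apply: Ideal_lin (IH gy).
Qed.

Lemma ideal_genM a x : ideal_gen G x -> ideal_gen G (a * x).
Proof.
elim=> [|b g {}x Gg _ IH]; first by rewrite mulr0; apply: Ideal_0.
by rewrite mulrDr mulrA; apply: Ideal_lin.
Qed.

Definition ideal_pred : {pred A} := fun x => `[< ideal_gen G x >].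

Lemma ideal_pred_zmod_closed : zmod_closed ideal_pred.
Proof.
split=> [|x y]; rewrite !unfold_in; first by apply/asboolP; apply: Ideal_0.
move=> /asboolP gx /asboolP gy; apply/asboolP; apply: ideal_genD => //.
by rewrite -mulN1r; apply: ideal_genM.
Qed.

HB.instance Definition _ :=
  GRing.isZmodClosed.Build A ideal_pred ideal_pred_zmod_closed.

Definition ideal_quot : Type := Quotient.quot (ideal_pred : zmodClosed A).
HB.instance Definition _ := GRing.Zmodule.on ideal_quot.

Let Q := Quotient.quot (ideal_pred : zmodClosed A).

Definition quot_map (x : A) : ideal_quot := (\pi_Q x)%qT.

Lemma quot_mapP x y : quot_map x = quot_map y <-> ideal_gen G (x - y).
Proof.
rewrite /quot_map; split=> [/eqP|gxy].
  by rewrite -Quotient.idealrBE unfold_in => /asboolP.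
by apply/eqP; rewrite -Quotient.idealrBE unfold_in; apply/asboolP.
Qed.

Lemma quot_map_surj (c : ideal_quot) : exists x, c = quot_map x.
Proof. by exists (repr (c : Q)); rewrite /quot_map reprK. Qed.

Lemma quot_map_is_zmod_morphism : zmod_morphism quot_map.
Proof. by move=> x y; rewrite /quot_map; apply: (raddfB (\pi_Q)%qT). Qed.
HB.instance Definition _ :=
  GRing.isZmodMorphism.Build A ideal_quot quot_map quot_map_is_zmod_morphism.

Definition quot_mul (c d : ideal_quot) : ideal_quot :=
  quot_map (repr (c : Q) * repr (d : Q)).

Lemma quot_mulE x y : quot_mul (quot_map x) (quot_map y) = quot_map (x * y).
Proof.
have rep z : ideal_gen G (repr (quot_map z : Q) - z).
  by apply/quot_mapP; rewrite {1}/quot_map reprK.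
apply/quot_mapP; set x' := repr _; set y' := repr _.
have -> : x' * y' - x * y = y' * (x' - x) + x * (y' - y) by ring.
by apply: ideal_genD; apply: ideal_genM; apply: rep.
Qed.

Lemma quot_mulA : associative quot_mul.
Proof.
move=> c d e; have [[x ->] [y ->] [z ->]] := And3 (quot_map_surj c)
  (quot_map_surj d) (quot_map_surj e).
by rewrite !quot_mulE mulrA.
Qed.

Lemma quot_mulC : commutative quot_mul.
Proof.
move=> c d; have [x ->] := quot_map_surj c; have [y ->] := quot_map_surj d.
by rewrite !quot_mulE mulrC.
Qed.

Lemma quot_mul1 : left_id (quot_map 1) quot_mul.
Proof. by move=> c; have [x ->] := quot_map_surj c; rewrite quot_mulE mul1r. Qed.

Lemma quot_mulD : left_distributive quot_mul +%R.
Proof.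
move=> c d e; have [[x ->] [y ->] [z ->]] := And3 (quot_map_surj c)
  (quot_map_surj d) (quot_map_surj e).
by rewrite !quot_mulE -!raddfD /= quot_mulE mulrDl.
Qed.

HB.instance Definition _ := GRing.Zmodule_isComPzRing.Build ideal_quot
  quot_mulA quot_mulC quot_mul1 quot_mulD.

Lemma quot_map_is_monoid_morphism : monoid_morphism quot_map.
Proof. by split=> // x y; rewrite -quot_mulE. Qed.
HB.instance Definition _ :=
  GRing.isMonoidMorphism.Build A ideal_quot quot_map quot_map_is_monoid_morphism.

End IdealQuotient.

(* [E x y a]: there is an edge between the vertices [x], [y] with label [a]. *)
Section StructureAlgebra.
Variables (V : Type) (S : comNzRingType) (E : V -> V -> S -> Prop).

Definition structure_pred : {pred (V -> S)} := fun z =>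
  `[< forall x y a, E x y a -> exists q, z x - z y = a * q >].

Lemma structure_subring_closed : subring_closed structure_pred.
Proof.
split; rewrite ?unfold_in.
- by apply/asboolP => x y a _; exists 0; rewrite subrr mulr0.
- move=> z t; rewrite !unfold_in => /asboolP Ez /asboolP Et; apply/asboolP.
  move=> x y a Exy; have [q qE] := Ez _ _ _ Exy; have [r rE] := Et _ _ _ Exy.
  exists (q - r); rewrite mulrBr -qE -rE.
  by change (z x - t x - (z y - t y) = z x - z y - (t x - t y)); ring.
- move=> z t; rewrite !unfold_in => /asboolP Ez /asboolP Et; apply/asboolP.
  move=> x y a Exy; have [q qE] := Ez _ _ _ Exy; have [r rE] := Et _ _ _ Exy.
  exists (q * t x + z y * r); change (z x * t x - z y * t y = a * (q * t x + z y * r)).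
  have -> : z x * t x - z y * t y = (z x - z y) * t x + z y * (t x - t y) by ring.
  by rewrite qE rE; ring.
Qed.

HB.instance Definition _ :=
  GRing.isSubringClosed.Build (V -> S) structure_pred structure_subring_closed.

Record structure_algebra := StructureAlgebra {
  struct_val :> V -> S;
  struct_valP : struct_val \in structure_pred }.

HB.instance Definition _ := [isSub for struct_val].
HB.instance Definition _ := [Choice of structure_algebra by <:].
HB.instance Definition _ := GRing.SubChoice_isSubComPzRing.Build
  (V -> S) structure_pred structure_algebra structure_subring_closed.

(* [I], [J] are subsets of [S], and [X x s s'] means that [s' = x(s)]. The
   reduced algebra is the quotient by [I . Z + Z . J], where [S] acts
   componentwise on the left, and [z . s = (z_x * x(s))_x] on the right. *)
Variables (I J : S -> Prop) (X : V -> S -> S -> Prop).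

Definition left_action (s : S) (z y : structure_algebra) : Prop :=
  forall x, y x = s * z x.

Definition right_action (z : structure_algebra) (s : S) (y : structure_algebra)
  : Prop := forall x s', X x s s' -> y x = z x * s'.

Definition reduced_gen (y : structure_algebra) : Prop :=
  (exists s z, I s /\ left_action s z y)
  \/ (exists z s, J s /\ right_action z s y).

Definition reduced_algebra : comPzRingType := ideal_quot reduced_gen.

Definition reduced_proj : {rmorphism structure_algebra -> reduced_algebra} :=
  @quot_map structure_algebra reduced_gen.

End StructureAlgebra.

(* The symmetric algebra of [A ^ m] is [{mpoly A[m]}]. *)
Definition sym_in (A : comNzRingType) (m : nat) (v : 'rV[A]_m) : {mpoly A[m]} :=
  \sum_(i < m) v 0 i *: 'X_i.

Definition augmentation_ideal (A : comNzRingType) (m : nat) (s : {mpoly A[m]})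
  : Prop := s@_0%MM = 0.

(* The element of Sym_A(A (x) Z^m) given by an element of Z^m. *)
Definition sym_int (A : comNzRingType) (m : nat) (v : 'rV[int]_m) : {mpoly A[m]} :=
  sym_in (map_mx intr v).

(* The morphism of symmetric algebras, over a morphism [phi] of scalars,
   induced by an additive map on Z^m, and by a linear map on A^m. *)
Definition sym_int_map (A B : comNzRingType) (phi : A -> B) (m q : nat)
    (f : 'rV[int]_m -> 'rV[B]_q) (s : {mpoly A[m]}) : {mpoly B[q]} :=
  mmap (fun a => (phi a)%:MP) (fun i => sym_in (f (delta_mx 0 i))) s.

Definition sym_map (A : comNzRingType) (m q : nat)
    (f : 'rV[A]_m -> 'rV[A]_q) (s : {mpoly A[m]}) : {mpoly A[q]} :=
  mmap (fun a => a%:MP) (fun i => sym_in (f (delta_mx 0 i))) s.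

(* Lambda = Z^m is the group of integer row vectors and its dual is the group of
   integer column vectors. *)
Definition pairing (m : nat) (f : 'cV[int]_m) (v : 'rV[int]_m) : int :=
  (v *m f) 0 0.

Record root_datum (m : nat) := RootDatum {
  roots : seq 'rV[int]_m;
  coroot : 'rV[int]_m -> 'cV[int]_m;
  roots_nonempty : roots != [::];
  roots_reduced : forall a, a \in roots -> a *+ 2 \notin roots;
  coroot_inj : {in roots &, injective coroot};
  coroot_root : forall a, a \in roots -> pairing (coroot a) a = 2;
  roots_refl : forall a b, a \in roots -> b \in roots ->
    b - pairing (coroot a) b *: a \in roots;
  coroots_refl : forall a b, a \in roots -> b \in roots ->
    coroot b - pairing (coroot b) a *: coroot a \in map coroot roots }.

Definition nonneg_comb (m : nat) (Delta : seq 'rV[int]_m) (b : 'rV[int]_m) : Prop :=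
  span_of (fun a : int => 0 <= a) (fun v => v \in Delta) b.

Definition simple_roots (m : nat) (D : root_datum m) (Delta : seq 'rV[int]_m)
  : Prop :=
  [/\ uniq Delta, {subset Delta <= roots D},
      forall c : 'rV[int]_m -> int, \sum_(a <- Delta) c a *: a = 0 ->
        {in Delta, forall a, c a = 0} &
      forall b, b \in roots D -> nonneg_comb Delta b \/ nonneg_comb Delta (- b)].

Definition positive_root (m : nat) (D : root_datum m) (Delta : seq 'rV[int]_m)
    (b : 'rV[int]_m) : Prop :=
  b \in roots D /\ nonneg_comb Delta b.

Definition root_lattice (m : nat) (D : root_datum m) (v : 'rV[int]_m) : Prop :=
  span_of (fun _ : int => True) (fun a => a \in roots D) v.

Section Quadratic.
Variables (k : idomainType) (c1 c2 : k).

Definition quad_poly : {poly k} := 'X^2 - c1 *: 'X + c2%:P.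
Definition disc : k := c1 ^+ 2 - 4 * c2.

Definition quad : comNzRingType := {poly %/ quad_poly}.
Definition quad_in : {rmorphism k -> quad} := qpolyC quad_poly.
Definition tau : quad := qpolyX quad_poly.
Definition sigma : quad := quad_in c1 - tau.

(* The coordinates y and y' of y + tau y'. *)
Definition quad_fst (z : quad) : k := (z : {poly %/ quad_poly})`_0.
Definition quad_snd (z : quad) : k := (z : {poly %/ quad_poly})`_1.

Variable n : nat.

(* The Weil restriction U of l^n is k^(n + n), with coordinates
   y_1, ..., y_n, y'_1, ..., y'_n. *)
Definition to_quad (u : 'rV[k]_(n + n)) : 'rV[quad]_n :=
  map_mx quad_in (lsubmx u) + tau *: map_mx quad_in (rsubmx u).

Definition of_quad (v : 'rV[quad]_n) : 'rV[k]_(n + n) :=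
  row_mx (map_mx quad_fst v) (map_mx quad_snd v).

Definition tau_op (u : 'rV[k]_(n + n)) : 'rV[k]_(n + n) :=
  of_quad (tau *: to_quad u).

Definition dot (A : comNzRingType) (q : nat) (u v : 'rV[A]_q) : A :=
  \sum_(i < q) u 0 i * v 0 i.

Definition B_tau (u v : 'rV[k]_(n + n)) : k :=
  quad_fst (dot (to_quad u) (to_quad v)).

Definition tau_rational (u : 'rV[k]_(n + n)) : Prop :=
  u <> 0 /\ exists a : k, dot (to_quad u) (to_quad u) = quad_in a.

Lemma tau_root : tau ^+ 2 = quad_in c1 * tau - quad_in c2.
Proof.
have qpE : quad_poly = 'X^2 + (c2%:P - c1 *: 'X) by rewrite /quad_poly; ring.
have sz2 : (size (c2%:P - c1 *: 'X : {poly k})%R < 3)%N.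
  rewrite (leq_ltn_trans (size_polyD _ _)) // gtn_max size_polyN.
  rewrite (leq_ltn_trans (size_polyC_leq1 _)) //=.
  by rewrite (leq_ltn_trans (size_scale_leq _ _)) // size_polyX.
have szq : size quad_poly = 3%N by rewrite qpE size_polyDl size_polyXn.
have monq : quad_poly \is monic.
  by rewrite monicE qpE lead_coefDl ?size_polyXn ?lead_coefXn.
have inC a : quad_in a = in_qpoly quad_poly a%:P.
  apply/val_inj; apply/esym; apply: (etrans (y := a%:P)) => //.
  apply: in_qpoly_small; by rewrite (leq_ltn_trans (size_polyC_leq1 _)) ?size_mk_monic_gt1.
have q0 : in_qpoly quad_poly quad_poly = 0.
  apply/val_inj; rewrite /= /mk_monic szq monq /=; exact: Pdiv.RingMonic.rmodpp.
apply/eqP; rewrite -subr_eq0; apply/eqP; rewrite -[RHS]q0 !inC /tau /qpolyX.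
rewrite -rmorphXn -rmorphM -rmorphB -rmorphB; congr (in_qpoly _ _).
by rewrite /quad_poly -mul_polyC; ring.
Qed.

Definition inv_tau_sigma : quad := quad_in disc^-1 * (tau - sigma).

Lemma inv_tau_sigmaP : disc \is a GRing.unit -> inv_tau_sigma * (tau - sigma) = 1.
Proof.
move=> uD; rewrite /inv_tau_sigma -mulrA.
have -> : (tau - sigma) * (tau - sigma) = quad_in disc.
  have -> : (tau - sigma) * (tau - sigma) =
      4 * tau ^+ 2 - 4 * (quad_in c1 * tau) + quad_in c1 ^+ 2.
    by rewrite /sigma; ring.
  by rewrite tau_root /disc rmorphB rmorphXn rmorphM rmorph_nat; ring.
by rewrite -rmorphM mulVr // rmorph1.
Qed.

Variables (R : realType) (kR : {rmorphism k -> R}).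

(* [kR] and [lR] are the inclusions of k and l in the real numbers. In the split
   case l is isomorphic to k x k since 2 is invertible. *)
Variant folding_case : Type :=
| Split of quad_poly = 'X^2 - 1 & (2 : k) \is a GRing.unit
| NonSplit (lR : {rmorphism quad -> R}) of
    injective lR & (forall a, lR (quad_in a) = kR a) & 0 < lR tau &
    (~ exists f : {rmorphism quad -> (k * k)%type}, bijective f).

Definition lstar (c : folding_case) : comNzRingType :=
  match c with Split _ _ => k | NonSplit _ _ _ _ _ => quad end.

Definition lstar_in (c : folding_case) : {rmorphism k -> lstar c} :=
  match c return {rmorphism k -> lstar c} with
  | Split _ _ => idfun
  | NonSplit _ _ _ _ _ => quad_in
  end.

Definition lstar_R (c : folding_case) : lstar c -> R :=
  match c return lstar c -> R with
  | Split _ _ => kR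
  | NonSplit lR _ _ _ _ => lR
  end.

(* The scalar extension of U to l_* is l_*^(n + n), that is U itself in the
   split case. The map pi_* takes its values in the submodule U_*. *)
Definition pi_star (c : folding_case) (u : 'rV[k]_(n + n))
    : 'rV[lstar c]_(n + n) :=
  match c return 'rV[lstar c]_(n + n) with
  | Split _ _ => 2^-1 *: (u + tau_op u)
  | NonSplit _ _ _ _ _ =>
      inv_tau_sigma *: (map_mx quad_in (tau_op u) - sigma *: map_mx quad_in u)
  end.

(* The l_*-linear extension of a k-linear endomorphism of U. *)
Definition ext_star (c : folding_case) (w : 'rV[k]_(n + n) -> 'rV[k]_(n + n))
    (v : 'rV[lstar c]_(n + n)) : 'rV[lstar c]_(n + n) :=
  v *m map_mx (lstar_in c) (lin1_mx w).

End Quadratic.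

Section Folding.
Variables (R : realType) (k : idomainType) (kR : {rmorphism k -> R}).
Variables (c1 c2 : k) (n m : nat).
Variables (D : root_datum m) (Delta : seq 'rV[int]_m).

Local Notation U := 'rV[k]_(n + n).
Local Notation T := (@tau_op k c1 c2 n).

(* The value at [u] of the coroot of [a]; a priori it is only in the fraction
   field of k. *)
Definition coroot_value (a u : U) : R := 2 * kR (dot a u) / kR (dot a a).

(* [emb] is the inclusion of Lambda in U and [refl a] is r_a for [a] in Phi. The
   set Lambda is stable under the [refl a] by [coroot_emb] and [reflE]. *)
Record folded_rep := FoldedRep {
  emb : {additive 'rV[int]_m -> U};
  refl : U -> {linear U -> U};
  delta_rat : seq 'rV[int]_m;
  emb_inj : injective emb;
  emb_tau : forall v, exists v', T (emb v) = emb v';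
  dotE : forall u v : U, dot u v = B_tau c1 c2 u v;
  coroot_emb : forall a v, a \in roots D ->
    (pairing (coroot D a) v)%:~R = coroot_value (emb a) (emb v);
  reflE : forall a (u : U), a \in roots D ->
    map_mx kR (refl (emb a) u) =
    map_mx kR u - coroot_value (emb a) u *: map_mx kR (emb a);
  refl_bij : forall a, a \in roots D -> bijective (refl (emb a));
  tau_lattice : forall u,
    (exists2 v, root_lattice D v & u = emb v) <->
    (exists2 v, root_lattice D v & u = T (emb v));
  delta_rat_rational : {in delta_rat, forall a, tau_rational c1 c2 (emb a)};
  (* as [emb] is injective and Delta is duplicate-free, the union is disjoint *)
  delta_partition :
    perm_eq [seq emb a | a <- Delta]
      ([seq emb a | a <- Delta & T (emb a) == emb a]
       ++ [seq emb a | a <- delta_rat] ++ [seq T (emb a) | a <- delta_rat]) }.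

Variable F : folded_rep.
Local Notation j := (emb F).

Definition k_span (Theta : seq 'rV[int]_m) (u : U) : Prop :=
  span_of (fun _ : k => True) (fun v => exists2 a, a \in Theta & v = j a) u.

Definition preserves (Theta : seq 'rV[int]_m) : Prop :=
  forall u, k_span Theta u <-> exists2 v, k_span Theta v & u = T v.

Definition dominant (u : U) : Prop :=
  {in Delta, forall b, 0 <= kR (B_tau c1 c2 u (j b))}.

(* The subgroup W_Theta; W itself is W_Delta. *)
Definition weyl (Theta : seq 'rV[int]_m) : (U -> U) -> Prop :=
  generated (fun w => exists2 a, a \in Theta & w = refl F (j a)).

(* [fold_gen a r]: [a] is in the union of Delta_rat and Delta^T, and [r] is the
   element of W whose restriction to U_* is R_{pi_*(a)}. *)
Definition fold_gen (a : 'rV[int]_m) (r : U -> U) : Prop :=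
  (a \in delta_rat F /\ r = refl F (T (j a)) \o refl F (j a))
  \/ [/\ a \in Delta, T (j a) = j a & r = refl F (j a)].

(* The subgroup W_{Theta_tau}, as a subgroup of W; W_tau itself is the case of
   Delta. *)
Definition weyl_tau (Theta : seq 'rV[int]_m) : (U -> U) -> Prop :=
  generated (fun r => exists2 a, a \in Theta & fold_gen a r).

Definition lattice_act (w : U -> U) (v : 'rV[int]_m) : 'rV[int]_m :=
  preimage_pt j (w (j v)).

Definition sym_act (w : U -> U) : {mpoly k[m]} -> {mpoly k[m]} :=
  sym_int_map (@idfun k) (fun v => map_mx intr (lattice_act w v)).

Definition sym_invariant (Theta : seq 'rV[int]_m) (s : {mpoly k[m]}) : Prop :=
  forall w, weyl Theta w -> sym_act w s = s.

Section StructureAlgebraG.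
Variables (Theta : seq 'rV[int]_m) (theta : U).

Definition vertexG : Type := orbit (weyl Delta) (fun w => w) theta.

Definition edgeG (x y : vertexG) (s : {mpoly k[m]}) : Prop :=
  exists a, [/\ positive_root D Delta a, sval y = refl F (j a) (sval x) &
                s = sym_int k a].

Definition ZG : comPzRingType := structure_algebra edgeG.

Definition twistG (x : vertexG) (s s' : {mpoly k[m]}) : Prop :=
  exists w, [/\ weyl Delta w, sval x = w theta & s' = sym_act w s].

Definition inv_ideal (s : {mpoly k[m]}) : Prop :=
  augmentation_ideal s /\ sym_invariant Theta s.

Definition reducedZG : comPzRingType :=
  reduced_algebra edgeG (@augmentation_ideal k m) inv_ideal twistG.
Definition projG : {rmorphism ZG -> reducedZG} :=
  reduced_proj edgeG (@augmentation_ideal k m) inv_ideal twistG.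

End StructureAlgebraG.

Variable c : folding_case c1 c2 kR.
Local Notation A := (lstar c).
Local Notation UA := 'rV[lstar c]_(n + n).
Local Notation pi := (@pi_star k c1 c2 n R kR c).
Local Notation ext := (@ext_star k c1 c2 n R kR c).

(* [lam_tau] is the isomorphism of l_*^q with Lambda_tau given by a basis. *)
Definition tau_basis (q : nat) (lam_tau : {linear 'rV[A]_q -> UA}) : Prop :=
  injective lam_tau /\
  forall v, (exists a, v = lam_tau a) <->
    span_of (fun _ : A => True) (fun v' => exists b, v' = pi (j b)) v.

Variables (q : nat) (lam_tau : {linear 'rV[A]_q -> UA}).

(* The element of S_tau given by an element of Lambda_tau. *)
Definition sym_tau (v : UA) : {mpoly A[q]} := sym_in (preimage_pt lam_tau v).

Definition pi_sym : {mpoly k[m]} -> {mpoly A[q]} :=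
  sym_int_map (lstar_in c) (fun v => preimage_pt lam_tau (pi (j v))).

Definition sym_tau_act (w : U -> U) : {mpoly A[q]} -> {mpoly A[q]} :=
  sym_map (fun a => preimage_pt lam_tau (ext w (lam_tau a))).

Definition sym_tau_invariant (Theta : seq 'rV[int]_m) (s : {mpoly A[q]}) : Prop :=
  forall w, weyl_tau Theta w -> sym_tau_act w s = s.

Definition simple_tau (v : UA) : Prop := exists a r, fold_gen a r /\ v = pi (j a).

(* [root_tau_pos b r]: [b = w(pi_*(a))] is in Phi_tau^+, and [r] is the element
   of W whose restriction to U_* is R_b. *)
Definition root_tau_pos (b : UA) (r : U -> U) : Prop :=
  (exists a w w' g,
     [/\ weyl_tau Delta w, cancel w w' /\ cancel w' w, fold_gen a g,
         b = ext w (pi (j a)) & r = w \o g \o w'])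
  /\ span_of (fun a : A => 0 <= lstar_R a) simple_tau b.

Section StructureAlgebraGTau.
Variables (Theta : seq 'rV[int]_m) (mu : UA).

Definition vertexGtau : Type := orbit (weyl_tau Delta) ext mu.

Definition edgeGtau (x y : vertexGtau) (s : {mpoly A[q]}) : Prop :=
  exists b r, [/\ root_tau_pos b r, sval y = ext r (sval x) & s = sym_tau b].

Definition ZGtau : comPzRingType := structure_algebra edgeGtau.

Definition twistGtau (x : vertexGtau) (s s' : {mpoly A[q]}) : Prop :=
  exists w, [/\ weyl_tau Delta w, sval x = ext w mu & s' = sym_tau_act w s].

Definition inv_ideal_tau (s : {mpoly A[q]}) : Prop :=
  augmentation_ideal s /\ sym_tau_invariant Theta s.

Definition reducedZGtau : comPzRingType :=
  reduced_algebra edgeGtau (@augmentation_ideal A q) inv_ideal_tau twistGtau.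
Definition projGtau : {rmorphism ZGtau -> reducedZGtau} :=
  reduced_proj edgeGtau (@augmentation_ideal A q) inv_ideal_tau twistGtau.

End StructureAlgebraGTau.

Definition is_iota (theta : U) (i : vertexGtau (pi theta) -> vertexG theta)
  : Prop :=
  forall y w, weyl_tau Delta w -> sval y = ext w (pi theta) ->
    sval (i y) = w theta.

End Folding.

(* Main.v *)
Require Import Defs.
From HB Require Import structures.
From mathcomp Require Import all_boot all_order all_algebra.
From mathcomp Require Import qpoly ring lra boolp reals mpoly.
From mathcomp Require classical_sets.

Set Implicit Arguments.
Unset Strict Implicit.
Unset Printing Implicit Defensive.

Import Order.TTheory GRing.Theory Num.Theory.
Local Open Scope ring_scope.

(* An element w of W_tau commutes with T: for tau-rational a, the product
   r_{T a} r_a is the l-linear reflection in a. Hence pi_* intertwines w on S with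
   w on S_tau, and an edge of G_tau lifts to one edge of G, or to two edges labelled
   by w a and T (w a), whose images under pi_* are proportional; so iota^* is
   defined.

   The map iota is well defined because pi_* is injective in the non-split case; in
   the split case, an element fixing pi_*(theta) fixes theta + T theta, a sum of two
   dominant vectors, hence fixes both.

   Finally iota^* maps the two generating families of the ideal to the
   corresponding families, because W_{Theta_tau} is contained in W_Theta: for a in
   Theta, T a is in the span of Theta, so it is orthogonal to theta, and W_Theta is
   the stabilizer of theta. *)

Local Notation roots := Defs.roots.

(** * The quadratic algebra and the operator T *)

Section Quadratic.
Variables (k : idomainType) (c1 c2 : k).
Local Notation quad := (quad c1 c2).
Local Notation quad_in := (quad_in c1 c2).
Local Notation tau := (tau c1 c2).
Local Notation sigma := (sigma c1 c2).
Local Notation p := (quad_poly c1 c2).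

Lemma size_mk_monic_quad : size (mk_monic p) = 3%N.
Proof.
have qpE : p = 'X^2 + (c2%:P - c1 *: 'X) by rewrite /quad_poly; ring.
have sz2 : (size (c2%:P - c1 *: 'X : {poly k})%R < 3)%N.
  rewrite (leq_ltn_trans (size_polyD _ _)) // gtn_max size_polyN.
  rewrite (leq_ltn_trans (size_polyC_leq1 _)) //=.
  by rewrite (leq_ltn_trans (size_scale_leq _ _)) // size_polyX.
have szq : size p = 3%N by rewrite qpE size_polyDl size_polyXn.
have monq : p \is monic.
  by rewrite monicE qpE lead_coefDl ?size_polyXn ?lead_coefXn.
by rewrite /mk_monic szq monq.
Qed.

(** A polynomial of degree at most 1 is its own remainder modulo the monic quadratic [p], so the two
    coordinates of an element of l can be read off as coefficients. *)
Lemma quad_in_tau_val (a b : k) :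
  (quad_in a + tau * quad_in b : {poly %/ p}) = a%:P + b *: 'X :> {poly k}.
Proof.
have sz : (size (a%:P + b *: 'X : {poly k})%R < size (mk_monic p))%N.
  rewrite size_mk_monic_quad (leq_ltn_trans (size_polyD _ _)) // gtn_max.
  rewrite (leq_ltn_trans (size_polyC_leq1 _)) //=.
  by rewrite (leq_ltn_trans (size_scale_leq _ _)) // size_polyX.
have inC x : quad_in x = in_qpoly p x%:P.
  apply/val_inj; apply/esym; apply: (etrans (y := x%:P)) => //.
  apply: in_qpoly_small.
  by rewrite size_mk_monic_quad (leq_ltn_trans (size_polyC_leq1 _)).
rewrite -(in_qpoly_small sz) !inC -rmorphM -rmorphD /=.
by rewrite -mul_polyC mulrC.
Qed.

Lemma quad_fstE a b : quad_fst (quad_in a + tau * quad_in b) = a.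
Proof.
rewrite /quad_fst quad_in_tau_val.
by rewrite coefD coefC coefZ coefX /= mulr0 addr0.
Qed.

Lemma quad_sndE a b : quad_snd (quad_in a + tau * quad_in b) = b.
Proof.
by rewrite /quad_snd quad_in_tau_val coefD coefC coefZ coefX /= mulr1 add0r.
Qed.

Lemma quad_inj a b a' b' :
  quad_in a + tau * quad_in b = quad_in a' + tau * quad_in b' -> a = a' /\ b = b'.
Proof.
move=> e; split; first by rewrite -(quad_fstE a b) e quad_fstE.
by rewrite -(quad_sndE a b) e quad_sndE.
Qed.

Lemma tau_mul a b : tau * (quad_in a + tau * quad_in b) =
  quad_in (- (c2 * b)) + tau * quad_in (a + c1 * b).
Proof.
have := tau_root c1 c2; rewrite rmorphN rmorphM rmorphD rmorphM => e.
by rewrite mulrDr mulrA -expr2 e; ring.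
Qed.

Variable n : nat.
Local Notation U := 'rV[k]_(n + n).
Local Notation T := (@tau_op k c1 c2 n).

Lemma to_quadE (u : U) i :
  to_quad c1 c2 u 0 i = quad_in (u 0 (lshift n i)) + tau * quad_in (u 0 (rshift n i)).
Proof. by rewrite !mxE. Qed.

Lemma tau_op_lshift (u : U) i : T u 0 (lshift n i) = - (c2 * u 0 (rshift n i)).
Proof.
rewrite /tau_op /of_quad row_mxEl mxE [X in quad_fst X]mxE to_quadE.
by rewrite tau_mul quad_fstE.
Qed.

Lemma tau_op_rshift (u : U) i :
  T u 0 (rshift n i) = u 0 (lshift n i) + c1 * u 0 (rshift n i).
Proof.
rewrite /tau_op /of_quad row_mxEr mxE [X in quad_snd X]mxE to_quadE.
by rewrite tau_mul quad_sndE.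
Qed.

Lemma to_quad_tau (u : U) : to_quad c1 c2 (T u) = tau *: to_quad c1 c2 u.
Proof.
apply/rowP => i; rewrite to_quadE [RHS]mxE to_quadE tau_mul.
by rewrite tau_op_lshift tau_op_rshift.
Qed.

Lemma tau_op_linear : linear T.
Proof.
move=> a u v; apply/rowP => i; rewrite [RHS]mxE [X in _ = X + _]mxE.
have : forall j, (a *: u + v) 0 j = a * u 0 j + v 0 j by move=> j; rewrite !mxE.
move: tau_op_lshift tau_op_rshift; move: T => f fl fr.
move: (a *: u + v) => w wE.
case: (split_ordP i) => i' ->.
  by rewrite !fl wE; ring.
by rewrite !fr !wE; ring.
Qed.

Lemma tau_op2 (u : U) : T (T u) = c1 *: T u - c2 *: u.
Proof.
move: tau_op_lshift tau_op_rshift; move: T => f fl fr.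
apply/rowP => i; rewrite [RHS]mxE [X in _ = X + _]mxE [X in _ = _ + X]mxE.
rewrite [X in _ = _ - X]mxE.
case: (split_ordP i) => i' ->.
  by rewrite fl fr fl; ring.
by rewrite fr fl fr; ring.
Qed.

Lemma dotC (A : comNzRingType) q (u v : 'rV[A]_q) : dot u v = dot v u.
Proof. by apply: eq_bigr => i _; rewrite mulrC. Qed.

Lemma dotDl (A : comNzRingType) q (u v w : 'rV[A]_q) :
  dot (u + v) w = dot u w + dot v w.
Proof. by rewrite /dot -big_split; apply: eq_bigr => i _; rewrite mxE mulrDl. Qed.

Lemma dotZl (A : comNzRingType) q a (u w : 'rV[A]_q) :
  dot (a *: u) w = a * dot u w.
Proof. by rewrite /dot mulr_sumr; apply: eq_bigr => i _; rewrite mxE mulrA. Qed.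

End Quadratic.

(** * Groups generated by involutions *)

Section Generated.
Variables (X : Type).
Implicit Types (G H : (X -> X) -> Prop) (P : (X -> X) -> Prop).

(** The inverse of a product of involutions is the reversed product. Hence every element is a finite
    product of generators, and the induction has no case for inverses. *)
Lemma generated_ind_invol G P : (forall g, G g -> involutive g) ->
    P id -> (forall g w, G g -> generated G w -> P w -> P (g \o w)) ->
  forall w, generated G w -> P w.
Proof.
move=> Ginv P1 PM.
(* [M] is the impredicative form of the monoid generated by [G]; the goal becomes that it is closed
   under inverses. *)
pose M (w : X -> X) := forall Q : (X -> X) -> Prop, Q id ->
  (forall g v, G g -> generated G v -> Q v -> Q (g \o v)) -> Q w.
have M1 : M id by [].
have Mg g w : G g -> generated G w -> M w -> M (g \o w).
  by move=> Gg Gw Mw Q Q1 QM; apply: (QM) => //; apply: Mw.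
have Mgen w : M w -> generated G w.
  by apply; [apply: Gen_id | move=> g v Gg Gv _; apply: Gen_mul].
have Mcomp w w2 : M w -> M w2 -> M (w \o w2).
  move=> Mw Mw2; apply: (Mw (fun w => M (w \o w2))) => // g v Gg Gv Mv.
  by apply: (Mg g (v \o w2)) => //; apply: Mgen Mv.
have Minv w : M w -> exists w', [/\ M w', cancel w w' & cancel w' w].
  move/(_ (fun w => exists w', [/\ M w', cancel w w' & cancel w' w])).
  apply=> [|g v Gg Gv [v' [Mv' vK v'K]]]; first by exists id.
  exists (v' \o g); split=> [|x|x] /=; rewrite ?(Ginv g Gg) ?vK //.
    by apply: Mcomp => //; apply: (Mg _ _ Gg (@Gen_id _ _) M1).
  by rewrite v'K (Ginv g Gg).
suff GM w : generated G w -> M w by move=> w /GM; apply.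
elim=> [|g {}w Gg Gw|{}w w' Gw Mw wK w'K]; [exact: M1 | exact: Mg |].
have [w'' [Mw'' wK'' w''K]] := Minv _ Mw.
(* An inverse is unique, so the given [w'] is the reversed product [w'']. *)
suff -> : w' = w'' by [].
by apply: funext => x; rewrite -[x in w'' x]w'K wK''.
Qed.

Lemma generated_comp G w w' : (forall g, G g -> involutive g) ->
  generated G w -> generated G w' -> generated G (w \o w').
Proof.
move=> Ginv Gw Gw'.
apply: (generated_ind_invol (P := fun w => generated G (w \o w')) Ginv _ _ Gw).
  exact: Gw'.
by move=> g v Gg _ Gv; apply: (Gen_mul Gg Gv).
Qed.

Lemma generated_in G g : G g -> generated G g.
Proof. by move=> Gg; apply: (Gen_mul Gg (@Gen_id _ _)). Qed.

Lemma generated_sub G H w : (forall g, H g -> involutive g) ->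
  (forall g, G g -> generated H g) -> generated G w -> generated H w.
Proof.
move=> Hinv GH; elim=> [|g {}w Gg _ Hw|{}w w' _ Hw]; first exact: Gen_id.
  by apply: generated_comp => //; apply: GH.
exact: Gen_inv.
Qed.

Lemma generated_inv G w : (forall g, G g -> involutive g) -> generated G w ->
  exists w', [/\ generated G w', cancel w w' & cancel w' w].
Proof.
move=> Ginv; move: w.
apply: (generated_ind_invol Ginv); first by exists id; split=> //; apply: Gen_id.
move=> g v Gg Gv [v' [Gv' vK v'K]].
exists (v' \o g); split=> [|x|x] /=; rewrite ?(Ginv g Gg) ?vK //.
  by apply: generated_comp => //; apply: generated_in.
by rewrite v'K (Ginv g Gg).
Qed.

End Generated.

Section TauLin.
Variables (k : idomainType) (c1 c2 : k) (n : nat).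
Local Notation U := 'rV[k]_(n + n).

(* [tau_lin] is an opaque copy of [tau_op]: conversion problems that unfold the
   arithmetic of the quotient ring are intractable. *)
Lemma tau_lin_exists : {f : {linear U -> U} | forall u, tau_op c1 c2 u = f u}.
Proof.
have L : {f : {linear U -> U} | f = @tau_op k c1 c2 n :> (_ -> _)}.
  pose M := GRing.isLinear.Build k U U *:%R _ (@tau_op_linear k c1 c2 n).
  by exists (HB.pack (@tau_op k c1 c2 n) M : {linear U -> U}).
by case: L => f fE; exists f => u; rewrite fE.
Qed.

Definition tau_lin := sval tau_lin_exists.

Lemma tau_linE u : tau_op c1 c2 u = tau_lin u.
Proof. exact: svalP tau_lin_exists u. Qed.

Lemma tau_lin2 u : tau_lin (tau_lin u) = c1 *: tau_lin u - c2 *: u.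
Proof. by rewrite -!tau_linE tau_op2. Qed.

Lemma to_quad_tau_lin u :
  to_quad c1 c2 (tau_lin u) = tau c1 c2 *: to_quad c1 c2 u.
Proof. by rewrite -to_quad_tau tau_linE. Qed.

End TauLin.

(** * Morphisms of quotient rings *)

Lemma rmorph_exists (A B : pzRingType) (f : A -> B) :
  zmod_morphism f -> monoid_morphism f ->
  exists g : {rmorphism A -> B}, forall x, g x = f x.
Proof.
move=> fB fM; pose Z := GRing.isZmodMorphism.Build A B f fB.
pose M := GRing.isMonoidMorphism.Build A B f fM.
by exists (HB.pack f Z M : {rmorphism A -> B}).
Qed.

Lemma ideal_quot_map (A B : comPzRingType) (G : A -> Prop) (H : B -> Prop)
    (f : {rmorphism A -> B}) :
  (forall x, G x -> ideal_gen H (f x)) ->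
  exists hat : {rmorphism ideal_quot G -> ideal_quot H},
    forall x, hat (quot_map G x) = quot_map H (f x).
Proof.
move=> GH.
have fG x : ideal_gen G x -> ideal_gen H (f x).
  elim=> [|a g {}x Gg _ IH]; first by rewrite rmorph0; apply: Ideal_0.
  by rewrite rmorphD rmorphM; apply: ideal_genD IH; apply: ideal_genM; apply: GH.
(* The value at a class does not depend on the representative, since [f] sends one ideal into the
   other; this makes it eligible for the axiom of choice. *)
have ex (c : ideal_quot G) :
    exists d, forall x, c = quot_map G x -> d = quot_map H (f x).
  have [x ->] := quot_map_surj c; exists (quot_map H (f x)) => y /quot_mapP xy.
  by apply/quot_mapP; rewrite -rmorphB; apply: fG.
have [h hE] := choice ex.
have hE' x : h (quot_map G x) = quot_map H (f x) by apply: hE.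
have hB : zmod_morphism h.
  move=> c d; have [x ->] := quot_map_surj c; have [y ->] := quot_map_surj d.
  by rewrite -rmorphB !hE' !rmorphB.
have hM : monoid_morphism h.
  split=> [|c d]; first by rewrite -(rmorph1 (quot_map G)) hE' !rmorph1.
  have [x ->] := quot_map_surj c; have [y ->] := quot_map_surj d.
  by rewrite -rmorphM !hE' !rmorphM.
by have [g gE] := rmorph_exists hB hM; exists g => x; rewrite gE.
Qed.

(** * Reflections *)

Lemma scalemxI (A : idomainType) p q (a : A) :
  a != 0 -> injective ( *:%R a : 'M[A]_(p, q) -> 'M[A]_(p, q)).
Proof.
move=> a0 M N /eqP; rewrite -subr_eq0 -scalerBr scalemx_eq0 (negPf a0) subr_eq0.
by move/eqP.
Qed.

Section Reflections.
Variables (R : realType) (k : idomainType) (kR : {rmorphism k -> R}).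
Hypothesis kR_inj : injective kR.
Variables (c1 c2 : k) (n m : nat) (D : root_datum m) (Delta : seq 'rV[int]_m).
Variable F : folded_rep kR c1 c2 n D Delta.
Local Notation U := 'rV[k]_(n + n).
Local Notation T := (tau_lin c1 c2 n).
Local Notation j := (emb F).
Local Notation r a := (refl F (j a)).

Lemma dotDr (A : comNzRingType) q (u v w : 'rV[A]_q) :
  dot u (v + w) = dot u v + dot u w.
Proof. by rewrite ![dot u _]dotC dotDl. Qed.

Lemma dotZr (A : comNzRingType) q a (u w : 'rV[A]_q) :
  dot u (a *: w) = a * dot u w.
Proof. by rewrite ![dot u _]dotC dotZl. Qed.

Lemma dotNl (A : comNzRingType) q (u w : 'rV[A]_q) : dot (- u) w = - dot u w.
Proof. by rewrite -scaleN1r dotZl mulN1r. Qed.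

Lemma dotNr (A : comNzRingType) q (u w : 'rV[A]_q) : dot u (- w) = - dot u w.
Proof. by rewrite ![dot u _]dotC dotNl. Qed.

Definition dot_bilin := (dotDl, dotDr, dotNl, dotNr, dotZl, dotZr).

Lemma dot_sqr_ge0 (u : U) : 0 <= kR (dot u u).
Proof.
by rewrite /dot rmorph_sum sumr_ge0 // => i _; rewrite rmorphM sqr_ge0.
Qed.

(** In the real numbers the dot square becomes a sum of squares of the coordinates, so the form is
    definite. *)
Lemma dot_sqr_eq0 (u : U) : dot u u = 0 -> u = 0.
Proof.
move=> u0; apply/rowP => i; rewrite mxE; apply: kR_inj; rewrite rmorph0.
have : \sum_(i < n + n) kR (u 0 i) ^+ 2 = 0.
  transitivity (kR (dot u u)); last by rewrite u0 rmorph0.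
  by rewrite /dot rmorph_sum; apply: eq_bigr => l _; rewrite rmorphM.
move=> /psumr_eq0P /(_ i isT) => h; apply/eqP; rewrite -sqrf_eq0 h //.
by move=> l _; rewrite sqr_ge0.
Qed.

(** Otherwise the numerator of [coroot_value] at the root itself would vanish, while its pairing
    with its coroot is 2. *)
Lemma dot_root_neq0 a : a \in roots D -> dot (j a) (j a) != 0.
Proof.
move=> aD; apply/eqP => a0.
have := coroot_emb F a aD; rewrite (coroot_root aD) /coroot_value a0.
by rewrite rmorph0 mulr0 mul0r => /eqP; rewrite intr_eq0.
Qed.

(** The reflection formula without denominators. As k need not be a field, identities between
    reflections are proved below after multiplication by the nonzero dot square of the root, which
    [scalemxI] then cancels. *)
Lemma refl_scale a u : a \in roots D ->
  dot (j a) (j a) *: r a u = dot (j a) (j a) *: u - (2 * dot (j a) u) *: j a.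
Proof.
move=> aD; have /rowP e := reflE F u aD.
apply/rowP => i; apply: kR_inj; move: (e i).
rewrite /coroot_value !mxE rmorphB !rmorphM rmorph_nat => ->.
have d0 : kR (dot (j a) (j a)) != 0.
  by rewrite -(rmorph0 kR) (inj_eq kR_inj) dot_root_neq0.
by field.
Qed.

Lemma refl_isom a u v : a \in roots D -> dot (r a u) (r a v) = dot u v.
Proof.
move=> aD; have d0 := dot_root_neq0 aD; set d := dot (j a) (j a) in d0.
apply: (mulfI d0); apply: (mulfI d0).
have -> : d * (d * dot (r a u) (r a v)) = dot (d *: r a u) (d *: r a v).
  by rewrite !dot_bilin.
by rewrite !refl_scale // !dot_bilin -/d [dot u (j a)]dotC; ring.
Qed.

(** The reflection formula involves only dot products and the root, so an isometry transports it. *)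
Lemma refl_conj (w : {linear U -> U}) a b : a \in roots D -> b \in roots D ->
    (forall u v, dot (w u) (w v) = dot u v) -> w (j a) = j b ->
  forall u, w (r a u) = r b (w u).
Proof.
move=> aD bD w_isom wab u; apply: (scalemxI (dot_root_neq0 bD)).
rewrite refl_scale // -wab !w_isom -linearZ /= refl_scale //.
by rewrite linearB !linearZ.
Qed.

Lemma refl_root a : a \in roots D -> r a (j a) = - j a.
Proof.
move=> aD; apply: (scalemxI (dot_root_neq0 aD)).
by rewrite refl_scale // -scalerBl scalerN -scaleNr; congr (_ *: _); ring.
Qed.

Lemma refl_invol a : a \in roots D -> involutive (r a).
Proof.
move=> aD u; apply: (scalemxI (dot_root_neq0 aD)).
rewrite -linearZ /= refl_scale // linearB !linearZ /= refl_root //.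
by rewrite opprK refl_scale // subrK.
Qed.

Lemma emb_scale (z : int) v : j (z *: v) = j v *~ z.
Proof. by rewrite -[z in LHS]intz scaler_int raddfMz. Qed.

Lemma refl_emb a v : a \in roots D ->
  r a (j v) = j (v - pairing (coroot D a) v *: a).
Proof.
move=> aD; apply/rowP => i; apply: kR_inj; have /rowP /(_ i) := reflE F (j v) aD.
rewrite -coroot_emb // raddfB emb_scale -scaler_int.
by rewrite !mxE rmorphB rmorphM rmorph_int.
Qed.

Lemma root_opp a : a \in roots D -> - a \in roots D.
Proof.
move=> aD; have := roots_refl aD aD; rewrite coroot_root //.
by rewrite scaler_nat mulr2n opprD addrA subrr sub0r.
Qed.

Lemma refl_opp a u : a \in roots D -> r (- a) u = r a u.
Proof.
move=> aD; apply: (scalemxI (dot_root_neq0 aD)).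
have := refl_scale u (root_opp aD).
rewrite raddfN !dot_bilin opprK => ->; rewrite refl_scale //.
by rewrite mulrN scalerN scaleNr opprK.
Qed.

Lemma refl_fix a u : a \in roots D -> r a u = u <-> dot (j a) u = 0.
Proof.
move=> aD; have d0 := dot_root_neq0 aD; have e := refl_scale u aD.
split=> [h|h]; last by apply: (scalemxI d0); rewrite e h mulr0 scale0r subr0.
have /eqP : (2 * dot (j a) u) *: j a = 0.
  by move: e; rewrite h => /(congr1 (fun x => - (x - dot (j a) (j a) *: u)));
    rewrite addrAC subrr sub0r opprK oppr0.
rewrite scalemx_eq0 mulf_eq0 => /orP[/orP[/eqP h2|/eqP//]|/eqP a0].
  have : kR 2 = 0 by rewrite h2 rmorph0.
  by move/eqP; rewrite rmorph_nat pnatr_eq0.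
by move: d0; rewrite a0 /dot big1 ?eqxx // => i _; rewrite mxE mul0r.
Qed.

(** Multiplication by tau moves across the l-bilinear dot product on l^n, hence across its first
    coordinate, which is the dot product on U. *)
Lemma dot_tau u v : dot (T u) v = dot u (T v).
Proof.
apply: etrans (dotE F _ _) _; apply: etrans _ (esym (dotE F _ _)).
rewrite /B_tau (to_quad_tau_lin c1 c2 u) (to_quad_tau_lin c1 c2 v).
move: (to_quad c1 c2 u) (to_quad c1 c2 v) (tau c1 c2) => u' v' t.
by apply: congr1; apply: etrans (dotZl t u' v') (esym (dotZr t u' v')).
Qed.

Lemma dot_delta (A : comNzRingType) q (u : 'rV[A]_q) i :
  dot (delta_mx 0 i) u = u 0 i.
Proof.
rewrite /dot (bigD1 i) //= mxE !eqxx mul1r big1 ?addr0 // => l li.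
by rewrite mxE (negPf li) andbF mul0r.
Qed.

(** For a coordinate vector [u] of the first half, [T u] is the matching vector of the second half,
    a unit vector orthogonal to [u]. Self-adjointness computes its dot square also as the product of
    [u] with c1 T u - c2 u, that is, as - c2. *)
Lemma c2E : c2 = - 1.
Proof.
(* A root has nonzero dot square, so U is nonzero and has a first coordinate. *)
have n_gt0 : (0 < n)%N.
  have [a aD] : exists a, a \in roots D.
    by case: (roots D) (roots_nonempty D) => // a s _; exists a; rewrite inE eqxx.
  rewrite lt0n; apply/eqP => n0; have := dot_root_neq0 aD.
  rewrite /dot big1 ?eqxx // => i _.
  by have := ltn_ord i; rewrite [X in (i < X + X)%N]n0.
pose i := Ordinal n_gt0; pose u : U := delta_mx 0 (lshift n i).
have Tu : T u = delta_mx 0 (rshift n i).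
  rewrite -tau_linE; apply/rowP => l; case: (split_ordP l) => l' ->.
    rewrite tau_op_lshift !mxE !eqxx !eq_lrshift eq_rlshift.
    by rewrite mulr0 oppr0.
  rewrite tau_op_rshift !mxE !eqxx eq_rlshift mulr0 addr0.
  by rewrite !(inj_eq (@rshift_inj _ _)) !(inj_eq (@lshift_inj _ _)).
have := dot_tau u (T u); rewrite tau_lin2 !dot_bilin {1 2}Tu dot_delta mxE !eqxx.
have -> : dot u (T u) = 0 by rewrite Tu dot_delta mxE eq_lrshift.
rewrite /u dot_delta mxE !eqxx mulr0 mulr1 sub0r /= => e.
by rewrite -[c2]opprK -e.
Qed.

Lemma tau_sqr u : T (T u) = c1 *: T u + u.
Proof.
rewrite tau_lin2 -scaleNr; have -> : - c2 = 1 by rewrite c2E opprK.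
by rewrite scale1r.
Qed.

Lemma dot_tau2 u v : dot (T u) (T v) = c1 * dot u (T v) + dot u v.
Proof. by rewrite dot_tau tau_sqr !dot_bilin. Qed.

Section FoldedPair.
Variables a d : 'rV[int]_m.
Hypotheses (aF : a \in delta_rat F) (aD : a \in roots D) (dD : d \in roots D).
Hypothesis adE : T (j a) = j d.

(** This is the first coordinate of tau times the l-valued dot square of [a]. The latter is in k
    because [a] is tau-rational, so the product has no first coordinate. *)
Lemma dot_fold_pair : dot (j a) (j d) = 0.
Proof.
have [_ [x xE]] := delta_rat_rational aF.
rewrite -adE; apply: etrans (dotE F _ _) _.
rewrite /B_tau (to_quad_tau_lin c1 c2 (j a)) dotC dotZl xE.
by rewrite -[_ * _]add0r -(rmorph0 (quad_in c1 c2)) quad_fstE.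
Qed.

Lemma dot_fold_norm : dot (j d) (j d) = dot (j a) (j a).
Proof. by rewrite -adE dot_tau2 adE dot_fold_pair mulr0 add0r. Qed.

(** The roots [a] and [d] are orthogonal and of equal norm, so the two corrections do not interact
    and share one denominator. *)
Lemma fold_pair_scale u : dot (j a) (j a) *: r d (r a u) =
  dot (j a) (j a) *: u - (2 * dot (j a) u) *: j a - (2 * dot (j d) u) *: j d.
Proof.
rewrite -{1}dot_fold_norm refl_scale // dot_fold_norm refl_scale //.
congr (_ - _ *: _); congr (2 * _); apply: (mulfI (dot_root_neq0 aD)).
by rewrite -dotZr refl_scale // !dot_bilin [dot (j d) (j a)]dotC dot_fold_pair; ring.
Qed.

Lemma fold_pair_comm u : r d (r a u) = r a (r d u).
Proof.
have fixd : r a (j d) = j d by apply/refl_fix => //; apply: dot_fold_pair.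
apply: esym; apply: (refl_conj (w := r a) dD dD) fixd u => u v.
exact: refl_isom.
Qed.

(** Both sides are expanded by [fold_pair_scale]; self-adjointness of T and the relation T^2 = c1 T
    + 1 match the coefficients of [j a] and [T (j a)]. *)
Lemma fold_pair_tau u : T (r d (r a u)) = r d (r a (T u)).
Proof.
have TB x y : T (x - y) = T x - T y by apply: raddfB.
have TZ x y : T (x *: y) = x *: T y by apply: linearZ.
apply: (scalemxI (dot_root_neq0 aD)); rewrite fold_pair_scale -TZ.
rewrite fold_pair_scale !TB !TZ -adE tau_sqr !dot_tau tau_sqr.
rewrite !dot_bilin; apply/rowP => i; rewrite !mxE; ring.
Qed.

End FoldedPair.

Lemma refl_tau_fixed a u : a \in roots D -> T (j a) = j a ->
  T (r a u) = r a (T u).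
Proof.
move=> aD aT; apply: (scalemxI (dot_root_neq0 aD)).
rewrite -linearZ /= !refl_scale // linearB !linearZ /= aT.
by rewrite -dot_tau aT.
Qed.

End Reflections.

(** * Weyl group and dominant vectors *)

Section Weyl.
Variables (R : realType) (k : idomainType) (kR : {rmorphism k -> R}).
Hypothesis kR_inj : injective kR.
Variables (c1 c2 : k) (n m : nat) (D : root_datum m) (Delta : seq 'rV[int]_m).
Variable F : folded_rep kR c1 c2 n D Delta.
Hypothesis simple_Delta : simple_roots D Delta.
Local Notation U := 'rV[k]_(n + n).
Local Notation T := (tau_lin c1 c2 n).
Local Notation j := (emb F).
Local Notation r a := (refl F (j a)).
Local Notation nonneg := (nonneg_comb Delta).

Lemma simple_root a : a \in Delta -> a \in roots D.
Proof. by case: simple_Delta => _ + _ _; apply. Qed.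

(** Repeated simple roots are collected, so that coefficients are indexed by roots and can be
    compared by [simple_free]. *)
Lemma nonneg_coef b : nonneg b ->
  exists c : 'rV[int]_m -> int, (forall a, 0 <= c a) /\ b = \sum_(a <- Delta) c a *: a.
Proof.
case=> q [y [x [y0 xD ->]]]; exists (fun a => \sum_(i | x i == a) y i).
split=> [a|]; first by apply: sumr_ge0.
under [RHS]eq_bigr => a _ do rewrite scaler_suml big_mkcond.
rewrite exchange_big; apply: eq_bigr => i _ /=.
have [uD _ _ _] := simple_Delta.
rewrite (bigD1_seq (x i)) //= eqxx big1 ?addr0 // => a /negPf.
by rewrite eq_sym => ->.
Qed.

Lemma simple_free (c : 'rV[int]_m -> int) : \sum_(a <- Delta) c a *: a = 0 ->
  {in Delta, forall a, c a = 0}.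
Proof. by case: simple_Delta => _ _ + _; apply. Qed.

Lemma nonneg_anti b : b \in roots D -> nonneg b -> nonneg (- b) -> False.
Proof.
move=> bD /nonneg_coef [c [c0 bE]] /nonneg_coef [c' [c'0 b'E]].
have cc : \sum_(a <- Delta) (c a + c' a) *: a = 0.
  under eq_bigr => a _ do rewrite scalerDl.
  by rewrite big_split /= -bE -b'E subrr.
have b0 : b = 0.
  rewrite bE big_seq big1 // => a aD; have := simple_free cc aD.
  by move=> /eqP; rewrite paddr_eq0 // => /andP[/eqP-> _]; rewrite scale0r.
by have := coroot_root bD; rewrite b0 /pairing mul0mx mxE.
Qed.

(** The reflection in [a] changes only the coefficient at [a]. If it makes a positive root negative,
    the other coefficients of that root must be 0. *)
Lemma refl_nonneg a b : a \in Delta -> b \in roots D -> nonneg b ->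
  nonneg (- (b - pairing (coroot D a) b *: a)) -> b = a.
Proof.
move=> aD bD /nonneg_coef [c [c0 bE]] /nonneg_coef [c' [c'0 b'E]].
set x := pairing _ _ in b'E.
have [uD _ _ _] := simple_Delta.
have cc : \sum_(d <- Delta) (c d + c' d - (if d == a then x else 0)) *: d = 0.
  under eq_bigr => d _ do rewrite scalerBl scalerDl.
  rewrite sumrB big_split /= -bE -b'E (bigD1_seq a) //= eqxx big1.
    by rewrite addr0 opprB addrC subrK subrr.
  by move=> d /negPf ->; rewrite scale0r.
have c_eq0 d : d \in Delta -> d != a -> c d = 0.
  move=> dD /negPf da; have := simple_free cc dD; rewrite da subr0.
  by move=> /eqP; rewrite paddr_eq0 // => /andP[/eqP].
have ba : b = c a *: a.
  rewrite bE (bigD1_seq a) //= big_seq_cond big1 ?addr0 // => d /andP[dD da].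
  by rewrite c_eq0 // scale0r.
(* Now [b] is [c a] times [a]. The pairing of [b] with its coroot is 2 and is divisible by [c a], so
   [c a] is 1 or 2, and 2 is impossible in a reduced datum. *)
have := coroot_root bD; rewrite {2}ba /pairing -scalemxAl mxE.
rewrite -/(pairing _ _); move: (pairing _ _) => y.
have := c0 a; case: (c a) ba => // [[|[|[|e]]]] ba _.
- by rewrite mul0r.
- by move=> _; rewrite ba scale1r.
- have := roots_reduced (simple_root aD).
  by rewrite -scaler_nat -[X in X *: a]/(2 : int) -ba bD.
- move=> h; have : absz (e.+3%:Z * y) = 2%N by rewrite h.
  rewrite abszM; case: (`|y|%N) => [|[|z]]; rewrite ?muln0 ?muln1 //.
  by rewrite !mulnS.
Qed.

Definition lattice_refl a v := v - pairing (coroot D a) v *: a.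

(** Words give the elements of W a length for induction; they act on U, and through [lattice_word]
    compatibly on Lambda and on the roots. *)
Fixpoint word (s : seq 'rV[int]_m) : {linear U -> U} :=
  if s is a :: s' then (r a \o word s')%FUN else idfun.

Fixpoint lattice_word (s : seq 'rV[int]_m) v :=
  if s is a :: s' then lattice_refl a (lattice_word s' v) else v.

Lemma word_emb s v : {subset s <= roots D} -> word s (j v) = j (lattice_word s v).
Proof.
elim: s => //= a s IH sD; rewrite IH; last first.
  by move=> x xs; apply: sD; rewrite inE xs orbT.
by rewrite refl_emb // sD // inE eqxx.
Qed.

Lemma lattice_word_root s b : {subset s <= roots D} -> b \in roots D ->
  lattice_word s b \in roots D.
Proof.
elim: s => //= a s IH sD bD; apply: roots_refl; first by rewrite sD // inE eqxx.
by apply: IH => // x xs; apply: sD; rewrite inE xs orbT.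
Qed.

Lemma word_isom s u v : {subset s <= roots D} ->
  dot (word s u) (word s v) = dot u v.
Proof.
elim: s => //= a s IH sD; rewrite refl_isom ?sD ?inE ?eqxx //.
by apply: IH => x xs; apply: sD; rewrite inE xs orbT.
Qed.

Lemma word_cat s1 s2 u : word (s1 ++ s2) u = word s1 (word s2 u).
Proof. by elim: s1 => //= a s1 ->. Qed.

(** The letters act from the right. The root must change sign at some letter [a], and by
    [refl_nonneg] the root reached just before is [a] itself. *)
Lemma word_flip s b : {subset s <= Delta} -> b \in roots D -> nonneg b ->
  nonneg (- lattice_word s b) ->
  exists s1 a s2, s = s1 ++ a :: s2 /\ lattice_word s2 b = a.
Proof.
move=> + bD b0; elim: s => [_ /(nonneg_anti bD b0)//|a s IH sD /= neg].
have sD' : {subset s <= Delta} by move=> x xs; apply: sD; rewrite inE xs orbT.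
have lD : lattice_word s b \in roots D.
  by apply: lattice_word_root => // x /sD'; apply: simple_root.
have aD : a \in Delta by rewrite sD // inE eqxx.
have [_ _ _ /(_ _ lD) [pos|/(IH sD')[s1 [a' [s2 [-> e]]]]]] := simple_Delta.
  by exists [::], a, s; split=> //; apply: refl_nonneg.
by exists (a :: s1), a', s2.
Qed.

Lemma dominant_nonneg x b : dominant F x -> nonneg b -> 0 <= kR (dot (j b) x).
Proof.
move=> xdom /nonneg_coef [c [c0 ->]].
have -> s : dot (j (\sum_(a <- s) c a *: a)) x =
    \sum_(a <- s) (c a)%:~R * dot (j a) x.
  elim: s => [|a s IH].
    by rewrite !big_nil raddf0 /dot big1 // => i _; rewrite mxE mul0r.
  by rewrite !big_cons raddfD /= dotDl IH emb_scale -scaler_int dotZl.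
rewrite rmorph_sum big_seq sumr_ge0 // => a aD.
rewrite rmorphM rmorph_int mulr_ge0 ?ler0z // dotC (dotE F).
exact: xdom.
Qed.

(* The induction is on the length of the word: if the last letter [b] is sent to
   a negative root by the preceding letters, then one of these cancels with it. *)
Lemma dominant_word_le s u x : {subset s <= Delta} -> dominant F u -> dominant F x ->
  kR (dot (word s u) x) <= kR (dot u x).
Proof.
move=> + udom xdom; have [N] := ubnP (size s); elim: N s => // N IH s.
case/lastP: s => // s b; rewrite size_rcons ltnS => sN sbD.
have sD : {subset s <= Delta}.
  by move=> y ys; apply: sbD; rewrite mem_rcons inE ys orbT.
have sD' y : y \in s -> y \in roots D by move=> /sD /simple_root.
have bD : b \in Delta by rewrite sbD // mem_rcons inE eqxx.
have bD' := simple_root bD.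
have [uD _ _ pn] := simple_Delta.
have lD : lattice_word s b \in roots D by apply: lattice_word_root.
have d0 := dot_root_neq0 F bD'.
have b0 : nonneg b.
  exists 1%N, (fun=> 1), (fun=> b); split=> //.
  by rewrite big_ord_recl big_ord0 addr0 scale1r.
rewrite -cats1 word_cat /=.
case: (pn _ lD) => [pos|/(word_flip sD bD' b0)[s1 [a [s2 [sE aE]]]]].
  (* Here [u] minus its image under the reflection in [b] is a nonnegative multiple of [j b], and
     [word s] sends [b] to a positive root, whose product with the dominant [x] is nonnegative. *)
  apply: le_trans (IH s sN sD).
  have dR : 0 < kR (dot (j b) (j b)).
    by rewrite lt_def dot_sqr_ge0 -(rmorph0 kR) (inj_eq kR_inj) d0.
  have WB y z : word s (y - z) = word s y - word s z by apply: raddfB.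
  have WZ e y : word s (e *: y) = e *: word s y by apply: linearZ.
  rewrite -(ler_pM2l dR) -!rmorphM -!dotZl -WZ refl_scale //.
  rewrite WB !WZ dotDl dotNl (dotZl (2 * _)) rmorphB gerBl word_emb //.
  rewrite 2!rmorphM rmorph_nat !mulr_ge0 //.
    by apply: dominant_nonneg.
  by apply: dominant_nonneg.
have s2D : {subset s2 <= roots D}.
  by move=> y ys; apply: sD'; rewrite sE mem_cat inE ys !orbT.
have aD : a \in roots D by apply: sD'; rewrite sE mem_cat inE eqxx orbT.
(* Since [word s2] takes [b] to [a], it conjugates one reflection into the other; the letters [a]
   and [b] cancel. *)
have -> : word s (r b u) = word (s1 ++ s2) u.
  rewrite sE !word_cat /= (refl_conj kR_inj (b := a) (w := word s2)) //.
  - by rewrite refl_invol.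
  - by move=> *; apply: word_isom.
  - by rewrite word_emb // aE.
apply: IH => [|y]; last by rewrite mem_cat => ys; apply: sD; rewrite sE mem_cat inE;
  case/orP: ys => ->; rewrite ?orbT.
by apply: leq_ltn_trans sN; rewrite sE !size_cat /= addnS.
Qed.

Lemma weyl_gen_invol (Theta : seq 'rV[int]_m) (g : U -> U) : {subset Theta <= Delta} ->
  (exists2 a, a \in Theta & g = r a) -> involutive g.
Proof.
by move=> sub [a aT ->]; apply: refl_invol => //; apply/simple_root/sub.
Qed.

Lemma weyl_word w : weyl F Delta w ->
  exists2 s, {subset s <= Delta} & w = word s.
Proof.
move: w; apply: generated_ind_invol.
- by move=> g; apply: weyl_gen_invol.
- by exists [::].
- move=> g w [a aD ->] _ [s sD ->]; exists (a :: s) => // x.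
  by rewrite inE => /orP[/eqP->|/sD].
Qed.

(** The products of [w u] with [u] and with [u'] are at most those of [u]. As [w] is an isometry
    fixing [u + u'], their sums agree, so both are equalities. The first one makes the dot square of
    [w u - u] vanish. *)
Lemma dominant_stab u u' w : dominant F u -> dominant F u' -> weyl F Delta w ->
  w (u + u') = u + u' -> w u = u.
Proof.
move=> ud u'd /weyl_word [s sD ->] e.
have isom := @word_isom s _ _ (fun a aD => simple_root (sD a aD)).
have := dominant_word_le sD ud u'd; have := dominant_word_le sD ud ud.
have : kR (dot (word s u) (u + u')) = kR (dot u (u + u')) by rewrite -{1}e isom.
rewrite !dotDr !rmorphD => h1 h2 h3.
have h : kR (dot (word s u) u) = kR (dot u u) by lra.
apply/eqP; rewrite -subr_eq0; apply/eqP/(dot_sqr_eq0 kR_inj).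
by rewrite !dot_bilin isom [dot u (word s u)]dotC (kR_inj h); ring.
Qed.

End Weyl.

(** * Folding *)

Section Fold.
Variables (R : realType) (k : idomainType) (kR : {rmorphism k -> R}).
Hypothesis kR_inj : injective kR.
Variables (c1 c2 : k) (n m : nat) (D : root_datum m) (Delta : seq 'rV[int]_m).
Variable F : folded_rep kR c1 c2 n D Delta.
Hypothesis simple_Delta : simple_roots D Delta.
Local Notation U := 'rV[k]_(n + n).
Local Notation T := (tau_lin c1 c2 n).
Local Notation j := (emb F).
Local Notation r a := (refl F (j a)).

Lemma mem_partition u : (u \in [seq j a | a <- Delta]) =
  (u \in [seq j a | a <- Delta & tau_op c1 c2 (j a) == j a]
       ++ [seq j a | a <- delta_rat F] ++ [seq tau_op c1 c2 (j a) | a <- delta_rat F]).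
Proof. exact: (perm_mem (delta_partition F)). Qed.

Lemma delta_ratP a : a \in delta_rat F ->
  a \in Delta /\ exists2 d, d \in Delta & T (j a) = j d.
Proof.
move=> aF; split.
  suff : j a \in [seq j a | a <- Delta].
    by rewrite (mem_map (@emb_inj _ _ _ _ _ _ _ _ _ F)).
  by rewrite mem_partition !mem_cat (map_f _ aF) orbT.
have : T (j a) \in [seq j a | a <- Delta].
  rewrite mem_partition -tau_linE !mem_cat.
  by rewrite (map_f (fun a => tau_op c1 c2 (j a)) aF) !orbT.
by case/mapP=> d dD e; exists d.
Qed.

Lemma fold_genP a (g : U -> U) : fold_gen F a g ->
  (exists d, [/\ a \in delta_rat F, a \in Delta, d \in Delta, T (j a) = j d &
     g = r d \o r a])
  \/ [/\ a \in Delta, T (j a) = j a & g = r a].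
Proof.
case=> [[aF ->]|[aD aT ->]]; last by right; split=> //; rewrite -tau_linE.
by left; have [aD [d dD e]] := delta_ratP aF; exists d; rewrite tau_linE e.
Qed.

Lemma fold_gen_invol a (g : U -> U) : fold_gen F a g -> involutive g.
Proof.
have root x := @simple_root m D Delta simple_Delta x.
case/fold_genP=> [[d [aF aD dD e ->]]|[aD aT ->]]; last first.
  by apply: refl_invol => //; apply: root.
move=> u /=; rewrite -(fold_pair_comm kR_inj aF) ?root //.
by rewrite !(refl_invol kR_inj) ?root.
Qed.

Lemma fold_gen_weyl a (g : U -> U) : fold_gen F a g -> weyl F Delta g.
Proof.
case/fold_genP=> [[d [aF aD dD e ->]]|[aD aT ->]]; last first.
  by apply: generated_in; exists a.
apply: Gen_mul; first by exists d.
by apply: generated_in; exists a.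
Qed.

Lemma weyl_tau_gen_invol (Theta : seq 'rV[int]_m) (g : U -> U) :
  (exists2 a, a \in Theta & fold_gen F a g) -> involutive g.
Proof. by case=> a _; apply: fold_gen_invol. Qed.

Lemma weyl_tau_weyl (Theta : seq 'rV[int]_m) (w : U -> U) :
  weyl_tau F Theta w -> weyl F Delta w.
Proof.
apply: generated_sub => [g|g [a _]]; last exact: fold_gen_weyl.
exact: (weyl_gen_invol kR_inj simple_Delta).
Qed.

Lemma weyl_tau_sub (Theta : seq 'rV[int]_m) (w : U -> U) :
  {subset Theta <= Delta} -> weyl_tau F Theta w -> weyl_tau F Delta w.
Proof.
move=> sub; apply: generated_sub => [g|g [a aT ag]].
  exact: weyl_tau_gen_invol.
by apply: generated_in; exists a => //; apply: sub.
Qed.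

Lemma weyl_tau_comm (Theta : seq 'rV[int]_m) (w : U -> U) u :
  weyl_tau F Theta w -> T (w u) = w (T u).
Proof.
have root x := @simple_root m D Delta simple_Delta x.
move=> Ww; elim: Ww u => // [g {}w [a _ ag] _ IH u|{}w w' _ IH wK w'K u]; last first.
  by rewrite -[LHS]wK -IH w'K.
rewrite /= -IH; case/fold_genP: ag => [[d [aF aD dD e ->]]|[aD aT ->]].
  by apply: fold_pair_tau; rewrite ?root.
by apply: refl_tau_fixed; rewrite ?root.
Qed.

Lemma weyl_linear (Theta : seq 'rV[int]_m) (w : U -> U) : {subset Theta <= Delta} ->
  weyl F Theta w -> exists L : {linear U -> U}, w = L.
Proof.
move=> sub Ww; have : weyl F Delta w.
  apply: generated_sub Ww => [g|g [a aT ->]].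
    exact: (weyl_gen_invol kR_inj simple_Delta).
  by apply: generated_in; exists a => //; apply: sub.
by case/(weyl_word kR_inj simple_Delta)=> s _ ->; exists (word F s).
Qed.

Lemma weyl_emb (w : U -> U) v : weyl F Delta w -> exists v', w (j v) = j v'.
Proof.
case/(weyl_word kR_inj simple_Delta)=> s sD ->; exists (lattice_word D s v).
by rewrite (word_emb kR_inj) // => x /sD; apply: simple_root.
Qed.

Lemma weyl_emb_root (w : U -> U) a : weyl F Delta w -> a \in roots D ->
  exists2 b, b \in roots D & w (j a) = j b.
Proof.
case/(weyl_word kR_inj simple_Delta)=> s sD -> aD; exists (lattice_word D s a).
  by apply: lattice_word_root => // x /sD; apply: simple_root.
by rewrite (word_emb kR_inj) // => x /sD; apply: simple_root.
Qed.

Lemma weyl_conj (w : U -> U) a b u : weyl F Delta w -> a \in roots D -> b \in roots D ->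
  w (j a) = j b -> w (r a u) = r b (w u).
Proof.
case/(weyl_word kR_inj simple_Delta)=> s sD -> aD bD e.
apply: (refl_conj kR_inj) => // x y; apply: (word_isom kR_inj).
by move=> z /sD; apply: simple_root.
Qed.

(* As [W_Theta] is the stabilizer of [theta], the roots [T a] with [a] in Theta
   are orthogonal to [theta], so their reflections are in [W_Theta]. *)
Lemma weyl_tau_parabolic (Theta : seq 'rV[int]_m) theta (w : U -> U) :
  {subset Theta <= Delta} -> preserves F Theta ->
  (forall w, weyl F Delta w -> (w theta = theta <-> weyl F Theta w)) ->
  weyl_tau F Theta w -> weyl F Theta w.
Proof.
move=> sub FTheta stab.
have root x := @simple_root m D Delta simple_Delta x.
have orth a : a \in Theta -> dot (j a) theta = 0.
  move=> aT; have aD := sub _ aT; apply/(refl_fix kR_inj); first exact: root.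
  by apply/stab; apply: generated_in; exists a.
have span_orth u : k_span F Theta u -> dot u theta = 0.
  case=> q [x [y [_ yT ->]]]; elim/big_ind: _ => [|u' v' hu hv|i _].
  - by rewrite /dot big1 // => i _; rewrite mxE mul0r.
  - by rewrite dotDl hu hv addr0.
  - by rewrite dotZl; have [a aT ->] := yT i; rewrite orth // mulr0.
apply: generated_sub => [g|g [a aT]].
  exact: (weyl_gen_invol kR_inj simple_Delta).
case/fold_genP=> [[d [aF aD dD e ->]]|[aD _ ->]]; last first.
  by apply: generated_in; exists a.
apply: generated_comp.
- move=> g'; exact: (weyl_gen_invol kR_inj simple_Delta).
- apply/stab; first by apply: generated_in; exists d.
  apply/(refl_fix kR_inj); first exact: root.
  apply: span_orth; apply/FTheta; exists (j a); last by rewrite tau_linE e.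
  exists 1%N, (fun=> 1), (fun=> j a); split=> //; first by exists a.
  by rewrite big_ord_recl big_ord0 addr0 scale1r.
- by apply: generated_in; exists a.
Qed.

End Fold.

(** * The projection to the eigenspace and the extension of scalars *)

Section Projection.
Variables (R : realType) (k : idomainType) (kR : {rmorphism k -> R}).
Variables (c1 c2 : k) (n : nat).
Hypothesis disc_unit : disc c1 c2 \is a GRing.unit.
Variable c : folding_case c1 c2 kR.
Local Notation U := 'rV[k]_(n + n).
Local Notation UA := 'rV[lstar c]_(n + n).
Local Notation T := (tau_lin c1 c2 n).
Local Notation pi := (@pi_star k c1 c2 n R kR c).
Local Notation ext := (@ext_star k c1 c2 n R kR c).
Local Notation h := (lstar_in c).

Lemma split_coef : quad_poly c1 c2 = 'X^2 - 1 -> c1 = 0 /\ c2 = - 1.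
Proof.
move=> /polyP e; split.
  have := e 1%N; rewrite /quad_poly !(coefD, coefN, coefZ, coefC, coefXn, coefX) /=.
  by rewrite mulr1 addr0 subr0 sub0r => /eqP; rewrite oppr_eq0 => /eqP.
have := e 0%N; rewrite /quad_poly !(coefD, coefN, coefZ, coefC, coefXn, coefX) /=.
by rewrite mulr0 subr0 add0r sub0r.
Qed.

Lemma tau_sigma : tau c1 c2 * sigma c1 c2 = quad_in c1 c2 c2.
Proof.
have := tau_root c1 c2; rewrite /sigma; move: (tau c1 c2) => t e.
by rewrite mulrBr -expr2 e mulrC opprB addrC subrK.
Qed.

(* The two cases of the folding, treated uniformly: [s] and [t] are the two
   eigenvalues of the tau-operator. *)
Lemma pi_starE : exists e s t : lstar c,
  [/\ forall u, pi u = e *: (map_mx h (T u) - s *: map_mx h u),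
      h c1 = t + s & h c2 = t * s].
Proof.
case: c => [e2 u2|lR lRi lRE lR0 ns] /=.
  have [c10 c21] := split_coef e2; exists 2^-1, (-1), 1; split.
  - move=> u; rewrite /= tau_linE scaleN1r opprK addrC; congr (_ *: (_ + _)).
      by apply/matrixP => a b; rewrite mxE.
    by apply/matrixP => a b; rewrite mxE.
  - by rewrite /= c10 subrr.
  - by rewrite /= c21 mul1r.
exists (inv_tau_sigma c1 c2), (sigma c1 c2), (tau c1 c2); split.
- by move=> u; rewrite /= tau_linE.
- by rewrite /sigma addrC subrK.
- by rewrite tau_sigma.
Qed.

Lemma pi_starD u v : pi (u + v) = pi u + pi v.
Proof.
have [e [s [t [piE _ _]]]] := pi_starE.
rewrite !piE (raddfD T) /= !(map_mxD h).
by rewrite -scalerDr; congr (_ *: _); rewrite scalerDr opprD addrACA.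
Qed.

Lemma pi_starZ a u : pi (a *: u) = h a *: pi u.
Proof.
have [e [s [t [piE _ _]]]] := pi_starE.
have TZ : T (a *: u) = a *: T u by apply: linearZ.
rewrite !piE TZ !map_mxZ; move: (map_mx h (T u)) (map_mx h u) => x y.
by apply/rowP => i; rewrite !mxE; ring.
Qed.

(** The operator satisfies (T - s)(T - t) = 0, so T - s turns T into multiplication by [t]. *)
Lemma pi_star_tau : exists t : lstar c, forall u, pi (T u) = t *: pi u.
Proof.
have [e [s [t [piE e1 e2]]]] := pi_starE; exists t => u.
rewrite !piE tau_lin2 map_mxB !map_mxZ e1 e2.
move: (map_mx h (T u)) (map_mx h u) => x y.
by apply/rowP => i; rewrite !mxE; ring.
Qed.

Lemma ext_star_pi (w : {linear U -> U}) u : (forall u, T (w u) = w (T u)) ->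
  ext w (pi u) = pi (w u).
Proof.
move=> wT; have [e [s [t [piE _ _]]]] := pi_starE.
have mw v : map_mx h (w v) = map_mx h v *m map_mx h (lin1_mx w).
  by rewrite -map_mxM mul_rV_lin1.
by rewrite /ext_star !piE wT !mw -scalemxAl mulmxBl -scalemxAl.
Qed.

Lemma ext_star_comp (w w' : {linear U -> U}) v : ext (w \o w') v = ext w (ext w' v).
Proof.
rewrite /ext_star; have -> : lin1_mx (w \o w') = lin1_mx w' *m lin1_mx w.
  apply/row_matrixP => i; rewrite row_mul.
  by rewrite !rowE !(mul_rV_lin1 w') mul_rV_lin1 mul_rV_lin1.
by rewrite map_mxM mulmxA.
Qed.

Let row_entry (A : comNzRingType) (f : {rmorphism k -> A}) s (a b a' b' : U) :
  map_mx f a - s *: map_mx f b = map_mx f a' - s *: map_mx f b' ->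
  forall i, f (a 0 i) - s * f (b 0 i) = f (a' 0 i) - s * f (b' 0 i).
Proof. by move=> /rowP e i; move: (e i); rewrite !mxE. Qed.

(** In the split case the projection sees only [u + T u]. In the non-split case T u - sigma u equals
    (T u - c1 u) + tau u, and independence of 1 and tau over k recovers [u]. *)
Lemma pi_star_inj u v : pi u = pi v ->
  u = v \/ (c1 = 0 /\ u + T u = v + T v).
Proof.
case: c => [e2 u2|lR lRi lRE lR0 ns] /= e.
  right; split; first by have [] := split_coef e2.
  move: e; rewrite (tau_linE c1 c2 u) (tau_linE c1 c2 v).
  move: (u + T u) (v + T v) => x y /(congr1 ( *:%R 2)).
  by rewrite !scalerA mulrV // !scale1r.
left; move: e; rewrite (tau_linE c1 c2 u) (tau_linE c1 c2 v).
have cancel_ts x y : inv_tau_sigma c1 c2 *: x = inv_tau_sigma c1 c2 *: y ->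
    x = y :> 'rV_(n + n).
  move: (inv_tau_sigmaP disc_unit); move: (inv_tau_sigma c1 c2) => e.
  move: (tau c1 c2 - sigma c1 c2) => f ef /(congr1 ( *:%R f)).
  by rewrite !scalerA mulrC ef !scale1r.
move=> /cancel_ts; move: (T u) (T v) => a a' e.
have inj a0 b0 a1 b1 := @quad_inj k c1 c2 a0 b0 a1 b1.
apply/rowP => i.
move: (@row_entry _ (quad_in c1 c2) _ _ _ _ _ e i); rewrite /sigma => {}e.
have [] // : a 0 i - c1 * u 0 i = a' 0 i - c1 * v 0 i /\ u 0 i = v 0 i.
move: e inj; move: (tau c1 c2) => t; move: (quad_in c1 c2) => f e inj.
apply: inj; rewrite !rmorphB !rmorphM.
transitivity (f (a 0 i) - (f c1 - t) * f (u 0 i)); first by ring.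
by rewrite e; ring.
Qed.

End Projection.

(** * Symmetric algebras *)

Section SymIn.
Variables (A : comNzRingType) (m : nat).
Implicit Types u v : 'rV[A]_m.

Lemma sym_inD u v : sym_in (u + v) = sym_in u + sym_in v.
Proof.
by rewrite /sym_in -big_split; apply: eq_bigr => i _; rewrite mxE scalerDl.
Qed.

Lemma sym_inZ a u : sym_in (a *: u) = a *: sym_in u.
Proof.
by rewrite /sym_in scaler_sumr; apply: eq_bigr => i _; rewrite mxE scalerA.
Qed.

Lemma sym_in0 : sym_in (0 : 'rV[A]_m) = 0.
Proof. by rewrite -(scale0r 0) sym_inZ scale0r. Qed.

Lemma sym_in_sum (I : Type) (s : seq I) (f : I -> 'rV[A]_m) :
  sym_in (\sum_(i <- s) f i) = \sum_(i <- s) sym_in (f i).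
Proof. exact: (big_morph _ sym_inD sym_in0). Qed.

End SymIn.

Lemma rmorph_mpoly_eq (A : comNzRingType) (m : nat) (B : comNzRingType)
    (f g : {rmorphism {mpoly A[m]} -> B}) :
    (forall a, f a%:MP = g a%:MP) -> (forall i, f 'X_i = g 'X_i) -> f =1 g.
Proof.
move=> fgC fgX s; rewrite [s]mpolyE !rmorph_sum; apply: eq_bigr => e _.
rewrite -mul_mpolyC !rmorphM fgC; congr (_ * _).
rewrite mpolyXE_id !rmorph_prod; apply: eq_bigr => i _.
by rewrite !rmorphXn fgX.
Qed.

Section SymMap.
Variables (A B : comNzRingType) (phi : {rmorphism A -> B}) (m q : nat).
Variable f : 'rV[int]_m -> 'rV[B]_q.

Lemma sym_int_map_rmorph : exists g : {rmorphism {mpoly A[m]} -> {mpoly B[q]}},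
  forall s, g s = sym_int_map phi f s.
Proof.
by exists (mmap (@mpolyC q B \o phi) (fun i => sym_in (f (delta_mx 0 i)))).
Qed.

Lemma sym_int_mapC a : sym_int_map phi f a%:MP = (phi a)%:MP.
Proof. exact: (@mmapC m A _ _ (@mpolyC q B \o phi)). Qed.

Lemma sym_int_mapX i : sym_int_map phi f 'X_i = sym_in (f (delta_mx 0 i)).
Proof. by rewrite [LHS](@mmapX m A _ _ (@mpolyC q B \o phi)) mmap1U. Qed.

Lemma sym_int_map_sym_int v : (forall u w, f (u - w) = f u - f w) ->
  sym_int_map phi f (sym_int A v) = sym_in (f v).
Proof.
move=> fB; have [g gE] := sym_int_map_rmorph.
pose M := GRing.isZmodMorphism.Build _ _ f fB.
pose f' : {additive 'rV[int]_m -> 'rV[B]_q} := HB.pack f M.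
rewrite -gE /sym_int /sym_in rmorph_sum.
transitivity (sym_in (\sum_(i < m) (v 0 i)%:~R *: f (delta_mx 0 i))).
  rewrite sym_in_sum; apply: eq_bigr => i _ /=.
  rewrite -mul_mpolyC rmorphM !gE sym_int_mapC sym_int_mapX mxE rmorph_int.
  by rewrite mul_mpolyC sym_inZ.
congr sym_in; rewrite [v in RHS]row_sum_delta -[f]/(f' : _ -> _) raddf_sum.
apply: eq_bigr => i _.
by rewrite scaler_int -raddfMz -[v 0 i in RHS]intz scaler_int.
Qed.

Lemma sym_int_map_aug s : augmentation_ideal s ->
  augmentation_ideal (sym_int_map phi f s).
Proof.
rewrite /augmentation_ideal => s0; have [g gE] := sym_int_map_rmorph.
(* Variables go to linear forms, so taking the constant term commutes with the map; this is checked
   on constants and variables. *)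
have e : (@mcoeff q B 0%MM \o g) =1 (phi \o @mcoeff m A 0%MM).
  apply: rmorph_mpoly_eq => [a|i] /=.
    by rewrite gE sym_int_mapC !mcoeffC !eqxx !mulr1.
  rewrite gE sym_int_mapX mcoeffX mnm1_eq0 rmorph0 /sym_in raddf_sum big1 // => l _.
  by rewrite /= mcoeffZ mcoeffX mnm1_eq0 mulr0.
by have := e s; rewrite /= gE => ->; rewrite s0 rmorph0.
Qed.

End SymMap.

Section SymMapLin.
Variables (A : comNzRingType) (m q : nat) (f : 'rV[A]_m -> 'rV[A]_q).

Lemma sym_map_rmorph : exists g : {rmorphism {mpoly A[m]} -> {mpoly A[q]}},
  forall s, g s = sym_map f s.
Proof.
by exists (mmap (@mpolyC q A) (fun i => sym_in (f (delta_mx 0 i)))).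
Qed.

Lemma sym_mapC a : sym_map f a%:MP = a%:MP.
Proof. exact: (@mmapC m A _ _ (@mpolyC q A)). Qed.

Lemma sym_mapX i : sym_map f 'X_i = sym_in (f (delta_mx 0 i)).
Proof. by rewrite [LHS](@mmapX m A _ _ (@mpolyC q A)) mmap1U. Qed.

Lemma sym_map_sym_in v : linear f -> sym_map f (sym_in v) = sym_in (f v).
Proof.
move=> fL; have [g gE] := sym_map_rmorph.
pose M := GRing.isLinear.Build _ _ _ _ f fL.
pose f' : {linear 'rV[A]_m -> 'rV[A]_q} := HB.pack f M.
rewrite -gE {1}/sym_in rmorph_sum.
transitivity (sym_in (\sum_(i < m) v 0 i *: f (delta_mx 0 i))).
  rewrite sym_in_sum; apply: eq_bigr => i _ /=.
  by rewrite -mul_mpolyC rmorphM !gE sym_mapC sym_mapX mul_mpolyC sym_inZ.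
congr sym_in; rewrite [v in RHS]row_sum_delta -[f]/(f' : _ -> _) linear_sum.
by apply: eq_bigr => i _; rewrite linearZ.
Qed.

End SymMapLin.

Lemma preimage_ptK (X : zmodType) (Y : Type) (f : X -> Y) x :
  injective f -> preimage_pt f (f x) = x.
Proof.
by move=> f_inj; apply: f_inj;
  exact: (@classical_sets.xgetI _ 0 (fun y => f y = f x) x erefl).
Qed.

(** * Structure algebras *)

Section Main.
Variables (R : realType) (k : idomainType) (kR : {rmorphism k -> R}).
Hypothesis kR_inj : injective kR.
Variables (c1 c2 : k) (n m : nat) (D : root_datum m) (Delta : seq 'rV[int]_m).
Variable F : folded_rep kR c1 c2 n D Delta.
Hypothesis simple_Delta : simple_roots D Delta.
Hypothesis disc_unit : disc c1 c2 \is a GRing.unit.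
Variable c : folding_case c1 c2 kR.
Local Notation U := 'rV[k]_(n + n).
Local Notation UA := 'rV[lstar c]_(n + n).
Local Notation T := (tau_lin c1 c2 n).
Local Notation j := (emb F).
Local Notation r a := (refl F (j a)).
Local Notation pi := (@pi_star k c1 c2 n R kR c).
Local Notation ext := (@ext_star k c1 c2 n R kR c).
Local Notation h := (lstar_in c).
Local Notation W := (weyl F Delta).
Local Notation Wt := (weyl_tau F Delta).
Implicit Types (w : U -> U).

Let weyl_of_tau w : Wt w -> W w := weyl_tau_weyl kR_inj simple_Delta (w := w).

Lemma weyl_tau_linear w : Wt w -> exists L : {linear U -> U}, w = L.
Proof. by move/weyl_of_tau; apply: (weyl_linear kR_inj simple_Delta). Qed.

Lemma weyl_tau_pi w u : Wt w -> ext w (pi u) = pi (w u).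
Proof.
move=> Ww; have comm x := weyl_tau_comm kR_inj simple_Delta x Ww.
by have [L LE] := weyl_tau_linear Ww; rewrite LE in comm *; apply: ext_star_pi.
Qed.

Lemma weyl_tau_ext_comp w w' v : Wt w -> Wt w' -> ext (w \o w') v = ext w (ext w' v).
Proof.
by move=> /weyl_tau_linear [L ->] /weyl_tau_linear [L' ->]; apply: ext_star_comp.
Qed.

Lemma weyl_comp w w' : W w -> W w' -> W (w \o w').
Proof. by apply: generated_comp => g; apply: (weyl_gen_invol kR_inj simple_Delta). Qed.

Lemma weyl_tau_comp w w' : Wt w -> Wt w' -> Wt (w \o w').
Proof.
by apply: generated_comp => g; apply: (weyl_tau_gen_invol kR_inj simple_Delta).
Qed.

(** * Injectivity of the projection on the orbit *)

(** When c1 = 0, T is an involution, so it permutes the simple roots by the partition of Delta;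
    being self-adjoint, it then preserves dominance. *)
Lemma dominant_tau u : c1 = 0 -> dominant F u -> dominant F (T u).
Proof.
move=> c10 udom b bD; rewrite -(dotE F) (dot_tau F).
have [b' b'D ->] : exists2 b', b' \in Delta & T (j b) = j b'.
  have := map_f j bD; rewrite mem_partition !mem_cat => /or3P[|/mapP[a aF e]|/mapP[a aF e]].
  - case/mapP=> a; rewrite mem_filter => /andP[/eqP e aD] ->.
    by exists a; rewrite // -tau_linE.
  - have [_ [d dD ad]] := delta_ratP aF; exists d => //.
    by rewrite e.
  - have [aD _] := delta_ratP aF; exists a => //.
    have cs x : c1 *: x = 0 :> U by rewrite c10 scale0r.
    by rewrite e tau_linE (tau_sqr F) cs add0r.
by rewrite (dotE F); apply: udom.
Qed.

(** If the projection is not injective, the equality says that the inverse of [w'] composed with [w]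
    fixes theta + T theta, and [dominant_stab] applies to these two dominant vectors. *)
Lemma pi_orbit_inj theta w w' : dominant F theta -> Wt w -> Wt w' ->
  pi (w theta) = pi (w' theta) -> w theta = w' theta.
Proof.
move=> dom Ww Ww' /(pi_star_inj disc_unit)[//|[c10 e]].
have [v [Wv wK vK]] := generated_inv
  (@weyl_tau_gen_invol _ _ _ kR_inj _ _ _ _ _ _ F simple_Delta Delta) Ww'.
have Wvw : W (v \o w) by apply: weyl_comp; apply: weyl_of_tau.
suff /(congr1 w') : (v \o w) theta = theta by rewrite /= vK.
apply: (dominant_stab kR_inj simple_Delta dom (dominant_tau c10 dom) Wvw).
have [L LE] := weyl_tau_linear Ww; have [L' LE'] := weyl_tau_linear Ww'.
have comm x := weyl_tau_comm kR_inj simple_Delta x Ww.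
have comm' x := weyl_tau_comm kR_inj simple_Delta x Ww'.
have wD x y : w (x + y) = w x + w y by rewrite LE raddfD.
have w'D x y : w' (x + y) = w' x + w' y by rewrite LE' raddfD.
by move: e; rewrite comm comm' -wD -w'D /= => ->; rewrite wK.
Qed.

(** * Coordinates on Lambda_tau and equivariance of the map of symmetric algebras *)

Variables (q : nat) (lam_tau : {linear 'rV[lstar c]_q -> UA}).
Hypothesis lam_tau_basis : tau_basis F lam_tau.
Local Notation P := (preimage_pt lam_tau).

Let lam_tau_inj : injective lam_tau. Proof. by case: lam_tau_basis. Qed.

(** [P] takes coordinates in the chosen basis, with default value 0 outside Lambda_tau; membership
    in the span is therefore to be checked at each use. *)
Lemma tau_latticeK v :
  span_of (fun _ : lstar c => True) (fun v' => exists b, v' = pi (j b)) v ->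
  lam_tau (P v) = v.
Proof.
by case: lam_tau_basis => _ /(_ v) <- [a ->]; rewrite preimage_ptK.
Qed.

Lemma tau_lattice_pi b : lam_tau (P (pi (j b))) = pi (j b).
Proof.
apply: tau_latticeK; exists 1%N, (fun=> 1), (fun=> pi (j b)).
split=> //; first by exists b.
by rewrite big_ord_recl big_ord0 addr0 scale1r.
Qed.

Lemma tau_lattice_ext w a :
  Wt w -> lam_tau (P (ext w (lam_tau a))) = ext w (lam_tau a).
Proof.
move=> Ww; apply: tau_latticeK.
have [p [x [y [_ yP ->]]]] : span_of (fun _ : lstar c => True)
    (fun v' => exists b, v' = pi (j b)) (lam_tau a).
  by case: lam_tau_basis => _ /(_ (lam_tau a)) <-; exists a.
exists p, x, (fun i => ext w (y i)); split=> // [i|].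
  have [b ->] := yP i; have [b' e] := weyl_emb kR_inj simple_Delta b (weyl_of_tau Ww).
  by exists b'; apply: etrans (weyl_tau_pi _ Ww) _; rewrite e.
rewrite /ext_star mulmx_suml; apply: eq_bigr => i _.
by rewrite -scalemxAl.
Qed.

Lemma pi_latticeB u v : P (pi (j (u - v))) = P (pi (j u)) - P (pi (j v)).
Proof.
have lamB x y : lam_tau (x - y) = lam_tau x - lam_tau y by apply: linearB.
have piB x y : pi (x - y) = pi x - pi y.
  by rewrite -scaleN1r pi_starD pi_starZ rmorphN rmorph1 scaleN1r.
have jB : j (u - v) = j u - j v by apply: raddfB.
apply: lam_tau_inj; apply: etrans (tau_lattice_pi _) _; apply: etrans _ (esym (lamB _ _)).
apply: etrans _ (esym (f_equal2 (fun x y => x - y)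
  (tau_lattice_pi u) (tau_lattice_pi v))).
by rewrite jB piB.
Qed.

Lemma ext_lattice_linear w : Wt w -> linear (fun a => P (ext w (lam_tau a))).
Proof.
have lamP x a b : lam_tau (x *: a + b) = x *: lam_tau a + lam_tau b.
  exact: linearP.
move=> Ww x a b; apply: lam_tau_inj; apply: etrans (tau_lattice_ext _ Ww) _.
apply: etrans _ (esym (lamP _ _ _)).
apply: etrans _ (esym (f_equal2 (fun y z => x *: y + z)
  (tau_lattice_ext a Ww) (tau_lattice_ext b Ww))).
by rewrite lamP /ext_star mulmxDl -scalemxAl.
Qed.

Lemma pi_sym_int a : pi_sym F lam_tau (sym_int k a) = sym_tau lam_tau (pi (j a)).
Proof. exact: (sym_int_map_sym_int _ _ pi_latticeB). Qed.

Lemma lattice_actE w v : W w -> j (lattice_act F w v) = w (j v).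
Proof.
case/(weyl_emb kR_inj simple_Delta v)=> v' e.
by rewrite /lattice_act e preimage_ptK //; apply: emb_inj.
Qed.

(** Both sides are ring morphisms in [s], so it suffices to treat constants and variables; a
    variable is a basis vector of Lambda, where this is the equivariance of the projection on U. *)
Lemma pi_sym_act w s : Wt w ->
  pi_sym F lam_tau (sym_act F w s) = sym_tau_act lam_tau w (pi_sym F lam_tau s).
Proof.
move=> Ww.
have [f fE] := sym_int_map_rmorph h (fun v => P (pi (j v))).
have [g gE] := sym_int_map_rmorph (@idfun k)
  (fun v => map_mx intr (lattice_act F w v) : 'rV[k]_m).
have [e eE] := sym_map_rmorph (fun a => P (ext w (lam_tau a))).
rewrite /sym_tau_act /pi_sym /sym_act -!fE -gE -eE.
apply: (rmorph_mpoly_eq (f := f \o g) (g := e \o f)) => [a|i] /=.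
  by rewrite gE fE eE sym_int_mapC !fE !sym_int_mapC sym_mapC.
rewrite gE fE eE sym_int_mapX fE sym_int_mapX sym_map_sym_in; last first.
  exact: ext_lattice_linear.
rewrite tau_lattice_pi weyl_tau_pi // -lattice_actE; last exact: weyl_of_tau.
exact: pi_sym_int.
Qed.

(** * The maps of vertices and of structure algebras *)

Variables (Theta : seq 'rV[int]_m) (theta : U).
Hypothesis Theta_sub : {subset Theta <= Delta}.
Hypothesis F_Theta : preserves F Theta.
Hypothesis theta_dominant : dominant F theta.
Hypothesis theta_stab :
  forall w, W w -> (w theta = theta <-> weyl F Theta w).
Local Notation mu := (pi theta).

(** A representative [w] is chosen for each vertex. By [pi_orbit_inj] the image does not depend on
    it, and projecting the image gives the vertex back, whence injectivity. *)
Lemma iota_exists : exists iota : vertexGtau F mu -> vertexG F theta,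
  is_iota iota /\ injective iota.
Proof.
have ex (y : vertexGtau F mu) : exists x : vertexG F theta,
    exists w, [/\ Wt w, sval y = ext w mu & sval x = w theta].
  case: y => y [w Ww yE].
  have xP : exists2 w', W w' & w theta = w' theta by exists w => //; apply: weyl_of_tau.
  by exists (exist _ (w theta) xP), w.
have [i iP] := choice ex; exists i; split=> [y w Ww yE|y y' e].
  have [w' [Ww' yE' ->]] := iP y; apply: (pi_orbit_inj theta_dominant Ww' Ww).
  by rewrite -(weyl_tau_pi theta Ww) -(weyl_tau_pi theta Ww') -yE -yE'.
have [w [Ww yE xE]] := iP y; have [w' [Ww' yE' xE']] := iP y'.
have : sval y = sval y'.
  by rewrite yE yE' (weyl_tau_pi theta Ww) (weyl_tau_pi theta Ww') -xE -xE' e.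
by case: (y) (y') => [y1 p1] [y2 p2] /= ee; apply: eq_exist.
Qed.

(** Edges carry positive labels only; a negative root has the same reflection as its opposite, and
    its label differs by a sign. *)
Lemma edge_root (z : ZG F theta) (x y : vertexG F theta) a : a \in roots D ->
  sval y = r a (sval x) -> exists s, z x - z y = sym_int k a * s.
Proof.
move=> aD e; have [_ _ _ /(_ a aD) pn] := simple_Delta.
have := struct_valP z; rewrite unfold_in => /asboolP zP.
case: pn => [pos|neg]; first by apply: zP; exists a.
have [s sE] : exists s, z x - z y = sym_int k (- a) * s.
  apply: zP; exists (- a); split=> //; first by split=> //; apply: root_opp.
  by rewrite (refl_opp kR_inj).
exists (- s); rewrite sE mulrN -mulNr; congr (_ * _).
rewrite /sym_int (_ : map_mx intr (- a) = - 1 *: map_mx intr a).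
  by rewrite sym_inZ scaleN1r.
by rewrite scaleN1r map_mxN.
Qed.

Variable iota : vertexGtau F mu -> vertexG F theta.
Hypothesis iotaP : is_iota iota.

Lemma iota_star_struct (z : ZG F theta) :
  (fun y => pi_sym F lam_tau (z (iota y))) \in
    structure_pred (@edgeGtau _ _ _ _ _ _ _ _ _ F c q lam_tau mu).
Proof.
have [f fE] := sym_int_map_rmorph h (fun v => P (pi (j v))).
rewrite unfold_in; apply/asboolP => x y _ [b [g0 [[+ _] yE ->]]].
case=> [a [w [w' [g [Ww [wK w'K] ag -> gE]]]]].
rewrite /pi_sym -!fE.
have aD : a \in Delta by case/fold_genP: ag => [[d []]|[]].
have Wg : Wt g by apply: generated_in; exists a.
have Ww' : Wt w' by apply: Gen_inv wK w'K.
have Wg0 : Wt g0.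
  by rewrite gE; apply: weyl_tau_comp => //; apply: weyl_tau_comp.
have [v Wv xE] := svalP x.
have ixE := iotaP Wv xE.
have iyE : sval (iota y) = g0 (v theta).
  by apply: (iotaP (weyl_tau_comp Wg0 Wv)); rewrite yE xE weyl_tau_ext_comp.
have root b' := @simple_root m D Delta simple_Delta b'.
have WWw := weyl_of_tau Ww.
have conj a' b' u (a'D : a' \in Delta) (b'D : b' \in roots D) (e : w (j a') = j b') :
  w (r a' u) = r b' (w u) := weyl_conj kR_inj simple_Delta u WWw (root _ a'D) b'D e.
have [a' a'D a'E] := weyl_emb_root kR_inj simple_Delta WWw (root _ aD).
have f_int b' : f (sym_int k b') = sym_tau lam_tau (pi (j b')).
  by rewrite fE; apply: pi_sym_int.
have fa' : f (sym_int k a') = sym_tau lam_tau (ext w (pi (j a))).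
  by rewrite f_int -a'E weyl_tau_pi.
(* If T fixes [a], the edge lifts to the single edge given by [a'], the image of [a] under [w]. *)
case/fold_genP: (ag) => [[d [aF _ dD adE gE']]|[_ aT gE']]; last first.
  have [s sE] : exists s, z (iota x) - z (iota y) = sym_int k a' * s.
    apply: edge_root => //; rewrite iyE ixE gE gE' /=.
    by rewrite (conj a a') // w'K.
  by exists (f s); rewrite -rmorphB sE rmorphM fa'.
have [d' d'D d'E] := weyl_emb_root kR_inj simple_Delta WWw (root _ dD).
(* The intermediate vertex: the reflection in [a'] takes [iota x] to [u], and the one in [d'] takes
   [u] to [iota y]. *)
pose u := w (r a (w' (v theta))).
have uP : exists2 w1, W w1 & u = w1 theta.
  exists (w \o (r a \o (w' \o v))) => //; apply: weyl_comp => //.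
  apply: Gen_mul; first by exists a.
  by apply: weyl_comp; apply: weyl_of_tau.
pose xu : vertexG F theta := exist _ u uP.
have [s sE] : exists s, z (iota x) - z xu = sym_int k a' * s.
  by apply: edge_root => //; rewrite ixE /= /u (conj a a') // w'K.
have [s' s'E] : exists s, z xu - z (iota y) = sym_int k d' * s.
  apply: edge_root => //; rewrite iyE gE gE' /= /u.
  by rewrite (conj d d').
have [t tE] := pi_star_tau n c.
(* As [w] commutes with T, [j d'] is T of [j a'], and T becomes the scalar [t] after projection; so
   both differences are divisible by the one label of the folded edge. *)
have pid' : pi (j d') = t *: pi (j a').
  by rewrite -d'E -adE -(weyl_tau_comm kR_inj simple_Delta _ Ww) tE a'E.
have lamZ a1 : lam_tau (t *: a1) = t *: lam_tau a1 by apply: linearZ.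
have Ppid' : P (pi (j d')) = t *: P (pi (j a')).
  apply: lam_tau_inj; apply: etrans (tau_lattice_pi _) _; apply: etrans pid' _.
  exact: esym (etrans (lamZ _) (congr1 ( *:%R t) (tau_lattice_pi a'))).
have fd' : f (sym_int k d') = t *: f (sym_int k a').
  apply: etrans (f_int d') _.
  apply: etrans _ (esym (congr1 ( *:%R t) (f_int a'))).
  exact: etrans (congr1 (@sym_in _ q) Ppid') (sym_inZ _ _).
exists (f s + t *: f s'); rewrite -rmorphB.
have -> : z (iota x) - z (iota y) = (z (iota x) - z xu) + (z xu - z (iota y)).
  by rewrite addrA subrK.
rewrite sE s'E rmorphD !rmorphM fd' fa' mulrDr; congr (_ + _).
by rewrite -scalerAl -scalerAr.
Qed.

Lemma iota_star_exists : exists f : {rmorphism ZG F theta -> ZGtau F lam_tau mu},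
  forall z y, f z y = pi_sym F lam_tau (z (iota y)).
Proof.
have [g gE] := sym_int_map_rmorph h (fun v => P (pi (j v))).
pose f (z : ZG F theta) : ZGtau F lam_tau mu := StructureAlgebra (iota_star_struct z).
have fP z y : f z y = g (z (iota y)) by rewrite gE.
have ext_eq (z z' : ZGtau F lam_tau mu) : (forall y, z y = z' y) -> z = z'.
  by move=> e; apply: val_inj; apply: funext.
have fB : zmod_morphism f.
  move=> z z'; apply: ext_eq => y; rewrite fP.
  apply: etrans (rmorphB g (z (iota y)) (z' (iota y))) _.
  by rewrite -!fP.
have fM : monoid_morphism f.
  split=> [|z z']; apply: ext_eq => y; rewrite fP; first exact: rmorph1.
  apply: etrans (rmorphM g (z (iota y)) (z' (iota y))) _.
  by rewrite -!fP.
by have [f' f'E] := rmorph_exists fB fM; exists f' => z y; rewrite f'E.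
Qed.

(** * Descent to the reduced algebras *)

Variable f : {rmorphism ZG F theta -> ZGtau F lam_tau mu}.
Hypothesis fE : forall z y, f z y = pi_sym F lam_tau (z (iota y)).

Lemma inv_ideal_pi s : inv_ideal F Theta s ->
  inv_ideal_tau F lam_tau Theta (pi_sym F lam_tau s).
Proof.
case=> s0 sinv; split; first exact: sym_int_map_aug.
move=> w Ww; have Ww' := weyl_tau_sub kR_inj simple_Delta Theta_sub Ww.
apply: etrans (esym (pi_sym_act s Ww')) _; congr (pi_sym _ _ _); apply: sinv.
exact: (weyl_tau_parabolic kR_inj simple_Delta Theta_sub F_Theta theta_stab Ww).
Qed.

(** A generator of the left or right family is sent to a generator of the same family, with the
    scalar replaced by its projection. *)
Lemma reduced_map_exists : exists hat : {rmorphism reducedZG F Theta theta ->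
    reducedZGtau F lam_tau Theta mu},
  forall z, hat (projG F Theta theta z) = projGtau F lam_tau Theta mu (f z).
Proof.
have [g gE] := sym_int_map_rmorph h (fun v => P (pi (j v))).
have fP z y : f z y = g (z (iota y)) by rewrite gE fE.
apply: ideal_quot_map => z zG.
suff fzG : reduced_gen (@augmentation_ideal (lstar c) q)
    (inv_ideal_tau F lam_tau Theta)
    (@twistGtau _ _ _ _ _ _ _ _ _ F c q lam_tau mu) (f z).
  rewrite -[f z]mul1r -[1 * _]addr0; apply: Ideal_lin fzG _; exact: Ideal_0.
case: zG => [[s [z' [s0 zE]]]|[z' [s [sJ zE]]]].
  left; exists (g s), (f z'); split; first by rewrite gE; apply: sym_int_map_aug.
  by move=> y; rewrite !fP zE rmorphM.
right; exists (f z'), (pi_sym F lam_tau s); split; first exact: inv_ideal_pi.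
move=> y _ [w [Ww yE ->]]; rewrite !fP.
(* The same [w] represents [y] in the orbit of mu and [iota y] in that of theta, so the two twists
   correspond under [pi_sym_act]. *)
rewrite (zE (iota y) (sym_act F w s)); last first.
  by exists w; split=> //; [apply: weyl_of_tau | apply: iotaP].
by rewrite rmorphM -pi_sym_act // [in RHS]/pi_sym -gE.
Qed.

End Main.

Theorem corollary6p7 (R : realType) (k : idomainType) (kR : {rmorphism k -> R})
    (kR_inj : injective kR)
    (c1 c2 : k) (c2_unit : c2 \is a GRing.unit)
    (disc_unit : disc c1 c2 \is a GRing.unit)
    (c : folding_case c1 c2 kR)
    (n m : nat) (D : root_datum m) (Delta : seq 'rV[int]_m)
    (simple_Delta : simple_roots D Delta)
    (F : folded_rep kR c1 c2 n D Delta)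
    (Theta : seq 'rV[int]_m) (Theta_sub : {subset Theta <= Delta})
    (F_Theta : preserves F Theta)
    (theta : 'rV[k]_(n + n)) (theta_dominant : dominant F theta)
    (theta_stab : forall w, weyl F Delta w ->
       (w theta = theta <-> weyl F Theta w))
    (q : nat) (lam_tau : {linear 'rV[lstar c]_q -> 'rV[lstar c]_(n + n)})
    (lam_tau_basis : tau_basis F lam_tau) :
  exists (iota : vertexGtau F (pi_star c theta) -> vertexG F theta)
         (iota_star : {rmorphism ZG F theta ->
                                 ZGtau F lam_tau (pi_star c theta)}),
    [/\ is_iota iota, injective iota,
        forall z y, iota_star z y = pi_sym F lam_tau (z (iota y)) &
        exists hat : {rmorphism reducedZG F Theta theta ->
                        reducedZGtau F lam_tau Theta (pi_star c theta)},
          forall z, hat (projG F Theta theta z) =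
                    projGtau F lam_tau Theta (pi_star c theta) (iota_star z)].
Proof.
have [iota [iotaP iota_inj]] :=
  iota_exists kR_inj simple_Delta disc_unit c theta_dominant.
have [f fE] := iota_star_exists kR_inj simple_Delta lam_tau_basis iotaP.
exists iota, f; split=> //.
exact: (reduced_map_exists kR_inj simple_Delta lam_tau_basis Theta_sub F_Theta theta_stab
          iotaP fE).
Qed.
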